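(* Let $G=(V,E)$ be an undirected, unweighted graph with $n$ vertices and $m$ edges, accessible only through an effective resistance oracle, and let $0<\varepsilon\le 1$. There exists a randomized algorithm that makes $O(n/\varepsilon^2+1/\varepsilon^4)$ effective resistance queries and that accepts with probability $1$ if $G$ is edge biconnected, and rejects with probability at least $2/3$ if $G$ is $\varepsilon$-far from being edge biconnected, i.e., if one needs to add more than $\varepsilon\cdot m$ edges to make $G$ edge biconnected.
   Context: For a graph with Laplacian $L=D-A$ (each edge has unit conductance), the effective resistance between vertices $u,v$ is $R(u,v)=(\mathbf{1}_u-\mathbf{1}_v)^T L^+(\mathbf{1}_u-\mathbf{1}_v)$, where $L^+$ is the Moore–Penrose pseudoinverse. An effective resistance (ER) query takes a pair $u,v$ and returns $R(u,v)$ for the hidden graph. An edge is a cut edge if deleting it increases the number of connected components; a graph is edge biconnected if it has no cut edges. *)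

(* Defs.v *)
From HB Require Import structures.
From mathcomp Require Import all_boot all_order all_algebra.
From mathcomp Require Import classical_sets reals.

Set Implicit Arguments.
Unset Strict Implicit.
Unset Printing Implicit Defensive.

Import Order.TTheory GRing.Theory Num.Theory.
Local Open Scope ring_scope.

(** * Simple graphs on the vertex set 'I_n *)

Record sgraph (n : nat) := SGraph {
  edges : {set {set 'I_n}};
  edges_card2 : forall e, e \in edges -> #|e| = 2%N
}.

(* Adjacency and the number of components depend on the edge set only, so that
   edge deletion is plain set difference. When all members of E have two
   elements, adj E is irreflexive because [set u; u] is a singleton. *)
Definition adj n (E : {set {set 'I_n}}) : rel 'I_n :=
  fun u v => [set u; v] \in E.

Definition num_components n (E : {set {set 'I_n}}) : nat :=
  n_comp (adj E) predT.

Definition num_edges n (G : sgraph n) : nat := #|edges G|.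

Definition cut_edge n (G : sgraph n) (e : {set 'I_n}) : Prop :=
  e \in edges G /\
  (num_components (edges G) < num_components (edges G :\ e))%N.

Definition edge_biconnected n (G : sgraph n) : Prop :=
  forall e, ~ cut_edge G e.

(* H ranges over the simple graphs obtained from G by adding edges. If no such
   H is edge biconnected (G a single edge on two vertices), G is far. *)
Definition far_from_edge_biconnected (R : realType) n (eps : R)
    (G : sgraph n) : Prop :=
  forall H : sgraph n, edges G \subset edges H -> edge_biconnected H ->
    eps * (num_edges G)%:R < #|edges H :\: edges G|%:R.

(** * Moore-Penrose pseudoinverse *)

Definition is_pinv (R : realType) m n (A : 'M[R]_(m, n)) (X : 'M[R]_(n, m)) :=
  [/\ A *m X *m A = A, X *m A *m X = X,
      (A *m X)^T = A *m X & (X *m A)^T = X *m A].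

Definition pinv (R : realType) m n (A : 'M[R]_(m, n)) : 'M[R]_(n, m) :=
  xget 0 (is_pinv A).

Lemma gram_unit (R : realType) r n (F : 'M[R]_(r, n)) :
  row_free F -> F *m F^T \in unitmx.
Proof.
move=> freeF; rewrite -row_free_unit -kermx_eq0.
apply/rowV0P => u /sub_kermxP uFF.
have uF0 : u *m F = 0.
  have : (u *m F) *m (u *m F)^T = 0.
    by rewrite trmx_mul mulmxA -(mulmxA u) uFF mul0mx.
  move=> /matrixP/(_ 0 0); rewrite !mxE => /eqP.
  rewrite psumr_eq0 => [/allP sq0|i _]; last by rewrite !mxE -expr2 sqr_ge0.
  apply/rowP => j; have := sq0 j (mem_index_enum j).
  by rewrite !mxE /= mulf_eq0 orbb => /eqP.
by apply/(row_free_inj freeF); rewrite mul0mx.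
Qed.

Lemma is_pinv_exists (R : realType) m n (A : 'M[R]_(m, n)) :
  exists X, is_pinv A X.
Proof.
have [r [C [F [defA freeF freeC]]]] : exists r (C : 'M[R]_(m, r)) (F : 'M[R]_(r, n)),
    [/\ C *m F = A, row_free F & row_free C^T].
  exists (\rank A), (col_base A), (row_base A).
  split; [exact: mulmx_base | exact: row_base_free |].
  by rewrite /row_free mxrank_tr; exact: col_base_full.
have UF := gram_unit freeF; have := gram_unit freeC; rewrite trmxK => UC.
set P := invmx (F *m F^T); set Q := invmx (C^T *m C).
have trP : P^T = P by rewrite trmx_inv trmx_mul trmxK.
have trQ : Q^T = Q by rewrite trmx_inv trmx_mul trmxK.
pose X := F^T *m P *m (Q *m C^T).
have AX : A *m X = C *m Q *m C^T.
  by rewrite -defA /X !mulmxA -(mulmxA C F) mulmxK.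
have XA : X *m A = F^T *m P *m F.
  by rewrite -defA /X !mulmxA -(mulmxA _ C^T C) mulmxKV.
exists X; split; rewrite ?AX ?XA.
- by rewrite -defA !mulmxA -(mulmxA _ C^T C) mulmxKV.
- by rewrite /X !mulmxA -(mulmxA _ F F^T) mulmxKV.
- by rewrite !trmx_mul trmxK trQ mulmxA.
- by rewrite !trmx_mul trmxK trP mulmxA.
Qed.

Lemma is_pinv_unique (R : realType) m n (A : 'M[R]_(m, n)) X Y :
  is_pinv A X -> is_pinv A Y -> X = Y.
Proof.
move=> [AXA XAX tAX tXA] [AYA YAY tAY tYA].
have AXY : A *m X = A *m Y.
  by rewrite -{1}AYA -mulmxA -tAY -tAX -trmx_mul mulmxA AXA tAY.
have XYA : X *m A = Y *m A.
  by rewrite -{1}AYA -mulmxA mulmxA -tYA -tXA -trmx_mul -mulmxA (mulmxA A X) AXA tYA.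
by rewrite -XAX -mulmxA AXY mulmxA XYA YAY.
Qed.

Lemma pinvP (R : realType) m n (A : 'M[R]_(m, n)) : is_pinv A (pinv A).
Proof. by have [X XP] := is_pinv_exists A; exact: (xgetPex 0 (ex_intro _ X XP)). Qed.

(** * Effective resistance *)

Definition degree n (G : sgraph n) (u : 'I_n) : nat :=
  #|[set v | adj (edges G) u v]|.

Definition laplacian (R : realType) n (G : sgraph n) : 'M[R]_n :=
  diag_mx (\row_u (degree G u)%:R) -
  \matrix_(u, v) (adj (edges G) u v)%:R.

Definition eff_res (R : realType) n (G : sgraph n) (u v : 'I_n) : R :=
  let d : 'cV[R]_n := delta_mx u 0 - delta_mx v 0 in
  (d^T *m pinv (laplacian R G) *m d) 0 0.

(** * Randomized query algorithms *)

(* An adaptive algorithm on the known vertex set 'I_n: it stops with a verdict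
   (true = accept), queries a pair of vertices and continues according to the
   real number returned, or draws a fresh uniform element of 'I_k.+1. The graph
   is seen only through the answers; in particular its number of edges is not
   an input. *)
Inductive query_alg (R : realType) (n : nat) : Type :=
| Verdict of bool
| Query of 'I_n & 'I_n & (R -> query_alg R n)
| Draw (k : nat) of ('I_k.+1 -> query_alg R n).

(* Worst case over the random draws. *)
Fixpoint num_queries (R : realType) n (oracle : 'I_n -> 'I_n -> R)
    (a : query_alg R n) : nat :=
  match a with
  | Verdict _ => 0%N
  | Query u v f => (num_queries oracle (f (oracle u v))).+1
  | Draw k f => (\max_(i < k.+1) num_queries oracle (f i))%N
  end.

Fixpoint prob_verdict (R : realType) n (oracle : 'I_n -> 'I_n -> R)
    (b : bool) (a : query_alg R n) : R :=
  match a with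
  | Verdict b' => (b' == b)%:R
  | Query u v f => prob_verdict oracle b (f (oracle u v))
  | Draw k f => k.+1%:R^-1 * \sum_(i < k.+1) prob_verdict oracle b (f i)
  end.

Definition prob_accept (R : realType) n (oracle : 'I_n -> 'I_n -> R)
    (a : query_alg R n) : R := prob_verdict oracle true a.

Definition prob_reject (R : realType) n (oracle : 'I_n -> 'I_n -> R)
    (a : query_alg R n) : R := prob_verdict oracle false a.

(* Main.v *)
Require Import Defs.
From HB Require Import structures.
From mathcomp Require Import classical_sets reals boolp.
From mathcomp Require Import all_boot all_order all_algebra.
From mathcomp Require Import ring lra zify.

Set Implicit Arguments.
Unset Strict Implicit.
Unset Printing Implicit Defensive.

Import Order.TTheory GRing.Theory Num.Theory.
Local Open Scope ring_scope.

(** Write [g] for the entries of the pseudoinverse [L^+]. Two complete rows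
    [R(u,_)] and [R(f,_)] of resistances determine the potential
    [x_uf(a) = g(a,u) - g(a,f)] of a unit current from [u] to [f] (in every
    graph, connected or not). If [uv] is a bridge and [f] lies on the side [T]
    of [v], then [x_uf] is constant on the side of [u] and drops by at least one
    on [T]; as a bridgeless graph has no edge cut of size one, comparing the
    flux through the boundaries of the two sides shows that no bridgeless graph
    has the same rows [u], [f] (and that of one more vertex when
    [x_uf(u) = 1/2]). Components [K2] escape this argument, but the rows of
    vertices of two such components already exclude every bridgeless graph.

    To find [f], let [X] be a sample of [O(1/eps)] vertices containing [u]. The
    vertices at which [x_uf'] is nonzero for every other [f'] in [X] lie in the
    component of [u] as soon as [X] minus [u] is not contained in a single other
    component, and some of them lie in [T] unless [X] meets [T]. One reaches [T]
    by picking such vertices and discarding those not separated by [u] from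
    the previous picks: each pick uses up a neighbour of [u]. If [X] contains
    three suitable bridge endpoints of degree [O(1/eps)], two of them suffice.
    Joining all bridge endpoints to two hubs destroys all bridges, so a graph
    that is far has more than [eps m / 8] bridge endpoints.

    The algorithm rejects iff no bridgeless graph agrees with the rows it has
    read, so it never rejects a bridgeless graph. Isolated vertices, among which
    the sample could get lost, are recognised by vanishing resistances. *)

Local Notation conn E := (connect (adj E)).

(** * Edge cuts and bridges *)

Section Connectivity.
Variable n : nat.
Implicit Types (E F : {set {set 'I_n}}) (G : sgraph n) (a b c u v : 'I_n).

Lemma adj_sym E : symmetric (adj E).
Proof. by move=> a b; rewrite /adj setUC. Qed.

Lemma conn_sym E : connect_sym (adj E).
Proof. exact: sym_connect_sym (adj_sym E). Qed.

Lemma conn_adjr E a b c : adj E b c -> conn E a b = conn E a c.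
Proof.
move=> bc; apply/idP/idP => h; first exact: connect_trans h (connect1 bc).
by apply: connect_trans h _; rewrite conn_sym connect1.
Qed.

Lemma adjxx G a : adj (edges G) a a = false.
Proof.
by apply/negP => /(@edges_card2 _ G); rewrite setUid cards1.
Qed.

Lemma conn_stable E (P : pred 'I_n) a b :
  (forall c d, P c -> adj E c d -> P d) -> conn E a b -> P a -> P b.
Proof.
move=> stP /connectP[p]; elim: p a => [|c p IH] a /=; first by move=> _ ->.
by case/andP=> ac pc eb Pa; apply: (IH c pc eb); apply: stP ac.
Qed.

Lemma conn_sub E F a b : E \subset F -> conn E a b -> conn F a b.
Proof.
by move=> sEF; apply: connect_sub => c d cd; apply: connect1; exact: (subsetP sEF).
Qed.

Lemma edgeP G e : e \in edges G -> exists u v, [/\ e = [set u; v], u != v & adj (edges G) u v].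
Proof.
move=> eE; have /eqP/cards2P[u [v [uv def_e]]] := edges_card2 eE.
by exists u, v; rewrite /adj -def_e.
Qed.

Lemma adj_rem E u v c d :
  adj E c d -> ~~ adj (E :\ [set u; v]) c d ->
  (c = u /\ d = v) \/ (c = v /\ d = u).
Proof.
rewrite /adj !inE negb_and negbK => -> /=; rewrite orbF => /eqP cd.
have : c \in [set u; v] by rewrite -cd set21.
have : d \in [set u; v] by rewrite -cd set22.
have : u \in [set c; d] by rewrite cd set21.
have : v \in [set c; d] by rewrite cd set22.
by rewrite !inE => /orP[]/eqP h1 /orP[]/eqP h2 /orP[]/eqP h3 /orP[]/eqP h4;
  intuition congruence.
Qed.

Lemma cut_edgeP G u v : adj (edges G) u v ->
  cut_edge G [set u; v] <-> ~~ conn (edges G :\ [set u; v]) u v.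
Proof.
move=> uv; set E := edges G; set E' := E :\ _.
have sE : E' \subset E by apply: subsetDl.
split=> [[_ lt_nc]|nuv].
  apply/negP => cuv; suff eqnc : num_components E = num_components E'.
    by move: lt_nc; rewrite -/E -/E' eqnc ltnn.
  apply: eq_n_comp => a b; apply/idP/idP; last exact: conn_sub.
  apply: connect_sub => c d cd; case: (boolP (adj E' c d)) => [/connect1//|ncd].
  by case: (adj_rem cd ncd) => [[-> ->]//|[-> ->]]; rewrite conn_sym.
split=> //; rewrite /num_components /n_comp_mem.
pose r' := [set x | roots (adj E') x]; pose r := [set x | roots (adj E) x].
have -> : #|predI (roots (adj E)) predT| = #|r|.
  by apply: eq_card => x; rewrite !inE andbT.
have -> : #|predI (roots (adj E')) predT| = #|r'|.
  by apply: eq_card => x; rewrite !inE andbT.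
pose ru := fingraph.root (adj E') u; pose rv := fingraph.root (adj E') v.
have ruv : ru != rv by rewrite /ru /rv root_connect //; exact: conn_sym.
have ru' : ru \in r' by rewrite inE roots_root //; exact: conn_sym.
have rv' : rv \in r' by rewrite inE roots_root //; exact: conn_sym.
(* Each component of [E] contains a component of [E'] other than that of [u]: for the component of
   [u] itself, [rv] represents one. So [E] has strictly fewer components. *)
have sub : r \subset (fingraph.root (adj E)) @: (r' :\ ru).
  apply/subsetP => x; rewrite inE => /eqP rx.
  pose y := fingraph.root (adj E') x.
  have xy : conn E x y by apply: conn_sub sE _; exact: connect_root.
  have [yru|yru] := eqVneq y ru; last first.
    apply/imsetP; exists y; first by rewrite !inE yru roots_root //; exact: conn_sym.
    rewrite -rx; apply/eqP; rewrite root_connect //.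
    exact: conn_sym.
  apply/imsetP; exists rv; first by rewrite !inE eq_sym ruv roots_root //; exact: conn_sym.
  rewrite -rx; apply/eqP; rewrite root_connect; last exact: conn_sym.
  apply: connect_trans xy _; rewrite yru.
  apply: (@connect_trans _ _ u); first by rewrite conn_sym; apply: conn_sub sE _; exact: connect_root.
  apply: (@connect_trans _ _ v); first exact: connect1.
  by apply: conn_sub sE _; exact: connect_root.
apply: leq_ltn_trans (subset_leq_card sub) _.
apply: leq_ltn_trans (leq_imset_card _ _) _.
by rewrite (cardsD1 ru r') ru'.
Qed.

(** Boundary edges are oriented out of [S], so that each is counted once and carries the sign used
    in [flux]. *)
Definition cut_pairs E (S : {set 'I_n}) : {set 'I_n * 'I_n} :=
  [set p | [&& p.1 \in S, p.2 \notin S & adj E p.1 p.2]].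

(** If a single edge leaves [S], no path leaves [S] after its deletion, so it is a bridge. *)
Lemma cut_pairs_neq1 G S : edge_biconnected G -> #|cut_pairs (edges G) S| != 1%N.
Proof.
move=> Gb; apply/negP => /cards1P[[a b] defP].
have : (a, b) \in cut_pairs (edges G) S by rewrite defP set11.
rewrite inE /= => /and3P[aS bS ab]; apply: (Gb [set a; b]).
apply/(cut_edgeP ab); apply/negP => cab.
suff : b \in S by apply/negP.
apply: (conn_stable (P := mem S)) cab aS => c d /= cS; rewrite /adj !inE => /andP[ncd cd].
apply/negPn/negP => dS; have : (c, d) \in cut_pairs (edges G) S by rewrite inE /= cS dS.
by rewrite defP inE => /eqP[ca db]; rewrite ca db eqxx in ncd.
Qed.

Lemma cut_pairs_ge2 G S : edge_biconnected G -> cut_pairs (edges G) S != set0 ->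
  (2 <= #|cut_pairs (edges G) S|)%N.
Proof.
move=> Gb; rewrite -card_gt0; have := cut_pairs_neq1 S Gb.
by case: #|_| => [|[|k]].
Qed.

End Connectivity.

(** * Dirichlet energy and the maximum principle *)

Section Potentials.
Variables (R : realType) (n : nat).
Implicit Types (E : {set {set 'I_n}}) (G : sgraph n) (x : 'I_n -> R).
Implicit Types (a b c u v f : 'I_n).

Definition lapf E x a : R := \sum_(b | adj E a b) (x a - x b).

Lemma lapfB E x y a : lapf E (fun b => x b - y b) a = lapf E x a - lapf E y a.
Proof. by rewrite /lapf -sumrB; apply: eq_bigr => b _; ring. Qed.

Lemma lapfN E x a : lapf E (fun b => - x b) a = - lapf E x a.
Proof. by rewrite /lapf -sumrN; apply: eq_bigr => b _; ring. Qed.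

(** Summation by parts. Every edge occurs in both orientations, whence the factor 2. *)
Lemma energy E x y :
  \sum_a y a * lapf E x a *+ 2 =
  \sum_a \sum_(b | adj E a b) (y a - y b) * (x a - x b).
Proof.
have sw : \sum_a \sum_(b | adj E a b) y b * (x a - x b) = - \sum_a y a * lapf E x a.
  rewrite (exchange_big_dep predT) //= -sumrN; apply: eq_bigr => a _.
  rewrite /lapf mulr_sumr -sumrN; apply: eq_big => [b|b _]; first by rewrite adj_sym.
  ring.
have -> : \sum_a \sum_(b | adj E a b) (y a - y b) * (x a - x b) =
  \sum_a y a * lapf E x a - \sum_a \sum_(b | adj E a b) y b * (x a - x b).
  rewrite -sumrB; apply: eq_bigr => a _; rewrite /lapf mulr_sumr -sumrB.
  by apply: eq_bigr => b _; ring.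
by rewrite sw opprK -big_split; apply: eq_bigr => a _; rewrite mulr2n.
Qed.

(** The edge terms of the energy are nonnegative with sum at most zero, so each vanishes. Taking
    [y = x] gives uniqueness of harmonic functions; taking for [y] a truncation of [x] gives the
    maximum principle. *)
Lemma energy_const E x y a b :
  (forall c d, adj E c d -> (y c - y d) ^+ 2 <= (y c - y d) * (x c - x d)) ->
  \sum_c y c * lapf E x c <= 0 -> conn E a b -> y a = y b.
Proof.
move=> le_yx le0 cab.
have nn c d : adj E c d -> 0 <= (y c - y d) * (x c - x d).
  by move=> cd; apply: le_trans (le_yx _ _ cd); apply: sqr_ge0.
have nn' c : 0 <= \sum_(d | adj E c d) (y c - y d) * (x c - x d).
  by apply: sumr_ge0 => d; apply: nn.
have /eqP eq0 : \sum_c \sum_(d | adj E c d) (y c - y d) * (x c - x d) == 0.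
  rewrite eq_le -{1}energy sumr_ge0 // andbT sumrMnl.
  exact: mulrn_wle0.
have yadj c d : adj E c d -> y c = y d.
  move=> cd; move/eqP: eq0; rewrite psumr_eq0 // => /allP/(_ c (mem_index_enum _)) /=.
  rewrite psumr_eq0; last by move=> ?; apply: nn.
  move=> /allP/(_ d (mem_index_enum _)) /=; rewrite cd /= => /eqP h0.
  have := le_yx _ _ cd; rewrite h0 => h; apply/eqP; rewrite -subr_eq0 -sqrf_eq0.
  by rewrite eq_le h sqr_ge0.
apply/eqP; apply: (conn_stable (P := fun d => y a == y d)) cab (eqxx _) => c d /eqP-> cd.
by rewrite (yadj _ _ cd).
Qed.

(** [Q] can be left only to [c]. The excess of [x] over [x c], clipped at zero and cut off outside
    [Q], is a test function for [energy_const]; it vanishes at [c], hence wherever [c] is connected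
    to. *)
Lemma max_principle E (Q : {pred 'I_n}) c x :
  (forall a b, a \in Q -> b \notin Q -> adj E a b -> b = c) ->
  (forall a, a \in Q -> lapf E x a <= 0) ->
  forall a, a \in Q -> conn E c a -> x a <= x c.
Proof.
move=> bdQ subQ a aQ ca.
pose y d := if d \in Q then Num.max (x d - x c) 0 else 0.
have yc : y c = 0 by rewrite /y subrr maxxx if_same.
have ya : y c = y a.
  apply: (energy_const (E := E) (x := x)) ca => [d e de|].
    have sq (r s : R) : (Num.max r 0 - Num.max s 0) ^+ 2 <=
        (Num.max r 0 - Num.max s 0) * (r - s).
      by rewrite /Num.max; case: ltP => r0; case: ltP => s0; rewrite ?lexx; nra.
    have key (r : R) : (Num.max r 0) ^+ 2 <= Num.max r 0 * r.
      by rewrite /Num.max; case: ltP => r0; nra.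
    rewrite /y; case: ifPn => dQ; case: ifPn => eQ.
    - by have := sq (x d - x c) (x e - x c); rewrite opprB addrA subrK.
    - by rewrite (bdQ d e) // subr0 key.
    - by rewrite (bdQ e d) //; [rewrite sub0r sqrrN -[x c - x e]opprB mulrNN key|rewrite adj_sym].
    - by rewrite subrr expr0n /= mul0r.
  apply: sumr_le0 => d _; rewrite /y; case: ifP => [dQ|_]; last by rewrite mul0r.
  by rewrite mulr_ge0_le0 ?subQ // le_max lexx orbT.
move: ya; rewrite yc /y aQ => /esym ya; rewrite -subr_le0 -ya le_max lexx //.
Qed.
End Potentials.

(** * The Moore-Penrose inverse of the Laplacian *)

Section Green.
Variables (R : realType) (n : nat).
Implicit Types (G : sgraph n) (a b c u v w f : 'I_n).

Definition green G a b : R := pinv (laplacian R G) a b.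

Definition pot G u f a : R := green G a u - green G a f.

Definition comp_size G u : nat := #|[set w | conn (edges G) u w]|.

Lemma laplacian_sym G : (laplacian R G)^T = laplacian R G.
Proof.
apply/matrixP => a b; rewrite !mxE adj_sym; congr (_ - _).
by have [->|_] := eqVneq a b; rewrite ?eqxx // ?mulr0n.
Qed.

Lemma mul_laplacian G m (M : 'M[R]_(n, m)) a j :
  (laplacian R G *m M) a j = lapf (edges G) (M ^~ j) a.
Proof.
rewrite /laplacian mulmxBl mul_diag_mx !mxE /lapf sumrB; congr (_ - _).
  by rewrite sumr_const /degree cardsE mulr_natl.
rewrite [RHS]big_mkcond; apply: eq_bigr => b _; rewrite mxE.
by case: adj; rewrite ?mul1r ?mul0r.
Qed.

Lemma green_sym G a b : green G a b = green G b a.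
Proof.
suff tP : (pinv (laplacian R G))^T = pinv (laplacian R G).
  by rewrite /green -[in LHS]tP mxE.
apply: (is_pinv_unique _ (pinvP _)).
have [h1 h2 h3 h4] := pinvP (laplacian R G); set L := laplacian R G in h1 h2 h3 h4 *.
have tL : L^T = L by apply: laplacian_sym.
split.
- by have := congr1 trmx h1; rewrite !trmx_mul tL mulmxA.
- by have := congr1 trmx h2; rewrite !trmx_mul tL mulmxA.
- by rewrite trmx_mul trmxK tL -h4 trmx_mul tL.
- by rewrite trmx_mul trmxK tL -h3 trmx_mul tL.
Qed.

Lemma lapf_const E (x : 'I_n -> R) a b :
  (forall c, lapf E x c = 0) -> conn E a b -> x a = x b.
Proof.
move=> x0; apply: (energy_const (x := x)) => [c d _|]; first by rewrite expr2.
by rewrite big1 // => c _; rewrite x0 mulr0.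
Qed.

(* The orthogonal projection onto the kernel of the Laplacian. *)
Let Q G : 'M[R]_n := 1%:M - laplacian R G *m pinv (laplacian R G).

Let Q_sym G a b : Q G a b = Q G b a.
Proof.
suff tQ : (Q G)^T = Q G by rewrite -[in LHS]tQ mxE.
by have [_ _ h _] := pinvP (laplacian R G); rewrite /Q linearB /= h trmx1.
Qed.

Let LQ G : laplacian R G *m Q G = 0.
Proof.
have [h1 h2 h3 h4] := pinvP (laplacian R G).
have : (Q G *m laplacian R G)^T = 0 by rewrite /Q mulmxBl mul1mx h1 subrr trmx0.
rewrite trmx_mul laplacian_sym => <-; congr (_ *m _).
by apply/matrixP => a b; rewrite [RHS]mxE Q_sym.
Qed.

Let Q_const G a b c : conn (edges G) a b -> Q G a c = Q G b c.
Proof.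
move=> ab; apply: (lapf_const (x := Q G ^~ c)) ab => d.
by have /matrixP/(_ d c) := LQ G; rewrite mul_laplacian [RHS]mxE.
Qed.

Let comp G u : 'cV[R]_n := \col_w (conn (edges G) u w)%:R.

Let L_comp G u : laplacian R G *m comp G u = 0.
Proof.
apply/matrixP => a j; rewrite mul_laplacian mxE /lapf big1 // => b ab.
by rewrite !mxE (conn_adjr _ ab) subrr.
Qed.

Let Q_comp G u : Q G *m comp G u = comp G u.
Proof.
have [h1 h2 h3 h4] := pinvP (laplacian R G).
rewrite /Q mulmxBl mul1mx -h3 trmx_mul laplacian_sym -mulmxA L_comp mulmx0.
exact: subr0.
Qed.

Let sum_comp G (x : 'I_n -> R) u :
  \sum_w x w * comp G u w 0 = \sum_(w | conn (edges G) u w) x w.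
Proof.
rewrite [RHS]big_mkcond; apply: eq_bigr => w _; rewrite mxE.
by case: connect; rewrite ?mulr1 ?mulr0.
Qed.

Lemma comp_size_gt0 G u : (0 < comp_size G u)%N.
Proof. by apply/card_gt0P; exists u; rewrite inE connect0. Qed.

(** The projection is constant on components and fixes their indicators. *)
Let Q_val G a b : Q G a b * (comp_size G b)%:R = (conn (edges G) b a)%:R.
Proof.
have /matrixP/(_ a 0) := Q_comp G b; rewrite [RHS]mxE => <-; rewrite [RHS]mxE sum_comp.
transitivity (\sum_(w | conn (edges G) b w) Q G a b).
  by rewrite sumr_const mulr_natr /comp_size cardsE.
by apply: eq_bigr => w bw; rewrite Q_sym [RHS]Q_sym; apply: Q_const.
Qed.

(** As [L L^+ = 1 - Q], column [u] of [L^+] is the potential of a unit charge at [u] balanced by a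
    uniform charge over its component. *)
Lemma lapf_green G u w : lapf (edges G) (green G ^~ u) w =
  (w == u)%:R - (conn (edges G) u w)%:R / (comp_size G u)%:R.
Proof.
rewrite -Q_val mulfK; last by rewrite pnatr_eq0 -lt0n comp_size_gt0.
rewrite -mul_laplacian /Q; set LP := _ *m _.
by rewrite !mxE; ring.
Qed.

(** [L L^+] is symmetric, hence kills the indicators of components as [L] does, and
    [L^+ = L^+ L L^+] inherits this. *)
Lemma sum_green G c a : \sum_(b | conn (edges G) c b) green G b a = 0.
Proof.
have [h1 h2 h3 h4] := pinvP (laplacian R G); set L := laplacian R G in h1 h2 h3 h4.
rewrite -sum_comp.
have : (pinv L *m comp G c) a 0 = 0.
  rewrite -h2 -mulmxA -mulmxA.
  have -> : L *m (pinv L *m comp G c) = 0; last by rewrite mulmx0 mxE.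
  by rewrite mulmxA -h3 trmx_mul laplacian_sym -mulmxA L_comp mulmx0.
by rewrite mxE => {2}<-; apply: eq_bigr => b _; rewrite green_sym.
Qed.

(** Restricted to the component of [a], column [b] is harmonic, hence constant; its sum there is
    zero. *)
Lemma green_disconn G a b : ~~ conn (edges G) a b -> green G a b = 0.
Proof.
move=> nab; pose x w := (conn (edges G) a w)%:R * green G w b.
have x0 w : lapf (edges G) x w = 0.
  have -> : lapf (edges G) x w = (conn (edges G) a w)%:R * lapf (edges G) (green G ^~ b) w.
    rewrite /lapf mulr_sumr; apply: eq_bigr => d wd.
    by rewrite /x (conn_adjr _ wd) mulrBr.
  case: (boolP (conn _ a w)) => aw; last by rewrite mul0r.
  rewrite lapf_green mul1r.
  have -> : (w == b) = false by apply: contraNF nab => /eqP <-.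
  have -> : conn (edges G) b w = false.
    by apply: contraNF nab => bw; apply: connect_trans aw _; rewrite conn_sym.
  by rewrite mul0r subrr.
have s0 := sum_green G a b.
have xa w : conn (edges G) a w -> green G w b = green G a b.
  by move=> aw; have := lapf_const x0 aw; rewrite /x aw connect0 !mul1r.
move: s0; rewrite (eq_bigr (fun=> green G a b)) // sumr_const => /eqP.
rewrite mulrn_eq0 => /orP[|/eqP//]; rewrite -cardsE => /eqP h.
by have := comp_size_gt0 G a; rewrite /comp_size h.
Qed.

(** Inside a common component the balancing charges of [u] and [f] cancel. *)
Lemma lapf_pot G u f w : conn (edges G) u f ->
  lapf (edges G) (pot G u f) w = (w == u)%:R - (w == f)%:R.
Proof.
move=> uf; rewrite /pot lapfB !lapf_green.
have same : conn (edges G) u =1 conn (edges G) f.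
  by move=> d; apply: same_connect => //; apply: conn_sym.
have -> : comp_size G u = comp_size G f.
  by apply: eq_card => d; rewrite !inE same.
by rewrite same; ring.
Qed.

Lemma eff_resE G u v : eff_res R G u v = green G u u + green G v v - green G u v *+ 2.
Proof.
rewrite /eff_res [in (_ - _)^T]linearB /=.
have tr w : (delta_mx w 0 : 'cV[R]_n)^T = delta_mx 0 w by rewrite trmx_delta.
rewrite !tr mulmxBl -!rowE mulmxBr -!colE !mxE.
by rewrite -!/(green _ _ _) (green_sym G v u); ring.
Qed.

End Green.

(** * Signs of potentials, isolated vertices, recovery of the graph, flux *)

Section Rows.
Variables (R : realType) (n : nat).
Implicit Types (G : sgraph n) (a b c u v w f : 'I_n).
Local Notation green := (@green R n).
Local Notation pot := (@pot R n).

Lemma sum_greenT G u : \sum_w green G w u = 0.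
Proof.
rewrite (bigID (conn (edges G) u)) /= sum_green add0r big1 // => w nuw.
by rewrite green_disconn // conn_sym.
Qed.

Lemma eff_res_sym G u v : eff_res R G u v = eff_res R G v u.
Proof. by rewrite !eff_resE green_sym; ring. Qed.

Definition resrow G u : {ffun 'I_n -> R} := [ffun w => eff_res R G u w].

(* Recovers the potential of a unit current from two rows of resistances; the
   mean of the differences is the difference of the diagonal entries of L^+. *)
Definition rdiff (r1 r2 : {ffun 'I_n -> R}) a : R :=
  ((\sum_w (r1 w - r2 w)) / n%:R - (r1 a - r2 a)) / 2.

Lemma rdiffE G u f a : rdiff (resrow G u) (resrow G f) a = pot G u f a.
Proof.
have n0 : n%:R != 0 :> R by rewrite pnatr_eq0 -lt0n; case: (a) => m; apply: leq_trans.
have -> : rdiff (resrow G u) (resrow G f) a =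
  ((\sum_w (eff_res R G u w - eff_res R G f w)) / n%:R
   - (eff_res R G u a - eff_res R G f a)) / 2.
  by rewrite /rdiff !ffunE; under eq_bigr do rewrite !ffunE.
have -> : \sum_w (eff_res R G u w - eff_res R G f w) =
    (green G u u - green G f f) * n%:R.
  rewrite (eq_bigr (fun w => (green G u u - green G f f)
     - (green G w u - green G w f) *+ 2)); last first.
    by move=> w _; rewrite !eff_resE (green_sym R G u w) (green_sym R G f w); ring.
  rewrite sumrB sumr_const card_ord sumrMnl sumrB !sum_greenT subrr mul0rn subr0.
  by rewrite mulr_natr.
rewrite mulfK // !eff_resE (green_sym R G u a) (green_sym R G f a) /pot.
by field.
Qed.

Lemma pot_opp G u f a : pot G u f a = - pot G f u a.
Proof. by rewrite /pot opprB. Qed.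

Lemma pot_outside G u f a : conn (edges G) u f -> ~~ conn (edges G) u a -> pot G u f a = 0.
Proof.
move=> uf ua; rewrite /pot !green_disconn ?subr0 //.
  by apply: contra ua => af; apply: connect_trans uf _; rewrite conn_sym.
by rewrite conn_sym.
Qed.

Lemma pot_max G u f a : conn (edges G) u f -> conn (edges G) u a ->
  pot G u f a <= pot G u f u.
Proof.
move=> uf ua; have [->//|au] := eqVneq a u.
apply: (@max_principle _ _ (edges G) (predC1 u)) => //.
  by move=> b c _; rewrite !inE negbK => /eqP.
move=> b; rewrite !inE => /negbTE bu; rewrite lapf_pot // bu sub0r oppr_le0.
exact: ler0n.
Qed.

Lemma sum_pot G u f c : \sum_(b | conn (edges G) c b) pot G u f b = 0.
Proof. by rewrite /pot sumrB !sum_green subrr. Qed.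

(** Otherwise the potential, maximal at [u], would be nonpositive with sum zero on the component,
    hence zero, and no current would leave [u]. *)
Lemma pot_gt0 G u f : conn (edges G) u f -> u != f -> 0 < pot G u f u.
Proof.
move=> uf nuf; rewrite ltNge; apply/negP => le0.
have all0 a : conn (edges G) u a -> pot G u f a = 0.
  move=> ua; apply/eqP; rewrite -oppr_eq0.
  have := sum_pot G u f u => /(congr1 -%R); rewrite oppr0 -sumrN => /eqP.
  rewrite psumr_eq0 => [/allP/(_ a (mem_index_enum _))|b ub].
    by rewrite ua.
  by rewrite oppr_ge0; apply: le_trans le0; apply: pot_max.
have := lapf_pot R u uf; rewrite eqxx (negbTE nuf) subr0 /lapf big1 => [/esym/eqP|b ub].
  by rewrite oner_eq0.
by rewrite !all0 ?connect0 ?subrr // connect1.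
Qed.

Lemma green_ge0 G u : 0 <= green G u u.
Proof.
have := sum_green R G u u => s0.
have h : 0 <= \sum_(b | conn (edges G) u b) (green G u u - green G b u).
  apply: sumr_ge0 => b ub; have [->|nub] := eqVneq b u; first by rewrite subrr.
  rewrite [green G b u]green_sym; apply: ltW; apply: (@pot_gt0 G u b) => //.
  by rewrite eq_sym.
move: h; rewrite sumrB s0 subr0 sumr_const pmulrn_lge0 //.
by rewrite -cardsE; exact: comp_size_gt0.
Qed.

Definition isolated G u := [forall w, ~~ adj (edges G) u w].

Lemma conn_isolated G u w : isolated G u -> conn (edges G) u w -> w = u.
Proof.
move=> /forallP iu uw; apply/eqP.
apply: (conn_stable (P := pred1 u)) uw (eqxx _) => c d /= /eqP-> ud.
by have := iu d; rewrite ud.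
Qed.

Lemma green_isolated G u : isolated G u -> green G u u = 0.
Proof.
move=> iu; have := sum_green R G u u; rewrite (big_pred1 u) // => w.
by apply/idP/eqP => [/(conn_isolated iu)//|->]; apply: connect0.
Qed.

Lemma green_gt0 G u : ~~ isolated G u -> 0 < green G u u.
Proof.
rewrite negb_forall => /existsP[w]; rewrite negbK => uw.
have nuw : u != w by apply: contraTneq uw => <-; rewrite adjxx.
rewrite lt_neqAle green_ge0 andbT; apply/negP => /eqP g0.
have lt0 b : conn (edges G) u b -> u != b -> green G b u < 0.
  by move=> ub nub; have := pot_gt0 ub nub; rewrite /pot -g0 (green_sym R G u b) sub0r oppr_gt0.
have := sum_green R G u u; rewrite (bigD1 u) ?connect0 //= -g0 add0r => s0.
have := lt0 _ (connect1 uw) nuw; rewrite ltNge => /negP; apply.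
rewrite -s0 (bigD1 w) /=; last by rewrite connect1 // eq_sym.
rewrite gerDl; apply: sumr_le0 => b /andP[/andP[ub nbu] _].
by apply/ltW/lt0 => //; rewrite eq_sym.
Qed.

Lemma eff_res_gt0 G u v : conn (edges G) u v -> u != v -> 0 < eff_res R G u v.
Proof.
move=> uv nuv; rewrite eff_resE.
have h1 := pot_gt0 uv nuv.
have h2 : 0 < pot G v u v by apply: pot_gt0; rewrite 1?conn_sym 1?eq_sym.
by move: h1 h2; rewrite /pot (green_sym R G v u); lra.
Qed.

Lemma eff_res_disconn G u v : ~~ conn (edges G) u v ->
  eff_res R G u v = green G u u + green G v v.
Proof. by move=> nuv; rewrite eff_resE [green G u v]green_disconn // mul0rn subr0. Qed.

(** Within a component the resistance is positive; between components it is the sum of two diagonal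
    entries of [L^+], which vanish exactly at isolated vertices. *)
Lemma eff_res_eq0 G u v : u != v ->
  (eff_res R G u v == 0) = isolated G u && isolated G v.
Proof.
move=> nuv; apply/eqP/andP => [r0|[iu iv]]; last first.
  rewrite eff_res_disconn ?green_isolated ?addr0 //.
  by apply: contraNN nuv => /(conn_isolated iu)->.
have nuv' : ~~ conn (edges G) u v.
  by apply/negP => /eff_res_gt0/(_ nuv); rewrite r0 ltxx.
move: r0; rewrite eff_res_disconn // => /eqP.
rewrite paddr_eq0 ?green_ge0 // => /andP[/eqP u0 /eqP v0].
by split; apply/negPn/negP => /green_gt0; rewrite ?u0 ?v0 ltxx.
Qed.

Lemma eff_resxx G u : eff_res R G u u = 0.
Proof. by rewrite eff_resE; ring. Qed.

(** The rows give every [x_uf(a)]; summing over [f] gives [n g(a,u)], because the rows of [L^+] sum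
    to zero. Being a pseudoinverse is a symmetric relation, so [L^+] determines [L], and [L] the
    edges. *)
Lemma eff_res_inj G G' :
  (forall u v, eff_res R G u v = eff_res R G' u v) -> edges G = edges G'.
Proof.
move=> eqR.
have eqrow u : resrow G u = resrow G' u by apply/ffunP => w; rewrite !ffunE.
have eqpot u f a : pot G u f a = pot G' u f a by rewrite -!rdiffE !eqrow.
have eqg a u : green G a u = green G' a u.
  have sumf H : \sum_f pot H u f a = green H a u * n%:R.
    rewrite /pot sumrB sumr_const card_ord mulr_natr.
    suff -> : \sum_f green H a f = 0 by rewrite subr0.
    rewrite -[RHS](sum_greenT H a).
    by apply: eq_bigr => f _; rewrite green_sym.
  have n0 : n%:R != 0 :> R by rewrite pnatr_eq0 -lt0n; case: (a) => m; apply: leq_trans.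
  by apply: (mulIf n0); rewrite -[LHS]sumf -[RHS]sumf; apply: eq_bigr => f _.
have eqLp : pinv (laplacian R G) = pinv (laplacian R G') by apply/matrixP => a b; apply: eqg.
have swap m k (A : 'M[R]_(m, k)) X : is_pinv A X -> is_pinv X A by case=> ? ? ? ?; split.
have eqL : laplacian R G = laplacian R G'.
  apply: (@is_pinv_unique _ _ _ (pinv (laplacian R G))); first exact/swap/pinvP.
  by rewrite eqLp; exact/swap/pinvP.
have eqadj u v : u != v -> adj (edges G) u v = adj (edges G') u v.
  move=> nuv; have /matrixP/(_ u v) := eqL; rewrite !mxE (negbTE nuv) !mulr0n !sub0r.
  by move/oppr_inj/eqP; rewrite eqr_nat; do 2!case: adj.
apply/setP => e; apply/idP/idP => /edgeP[u [v [-> nuv]]].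
  by rewrite eqadj.
by rewrite -eqadj.
Qed.

(** Discrete divergence theorem: currents inside [S] cancel in pairs. *)
Lemma flux E (S : {set 'I_n}) (x : 'I_n -> R) :
  \sum_(a in S) lapf E x a = \sum_(p in cut_pairs E S) (x p.1 - x p.2).
Proof.
pose F a b := if adj E a b then x a - x b else 0.
have -> : \sum_(a in S) lapf E x a = \sum_(a in S) \sum_b F a b.
  by apply: eq_bigr => a _; rewrite /lapf big_mkcond.
have -> : \sum_(a in S) \sum_b F a b = \sum_(a in S) \sum_(b | b \notin S) F a b.
  have -> : \sum_(a in S) \sum_b F a b =
    \sum_(a in S) \sum_(b in S) F a b + \sum_(a in S) \sum_(b | b \notin S) F a b.
    by rewrite -big_split /=; apply: eq_bigr => a _; rewrite (bigID (mem S)).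
  suff -> : \sum_(a in S) \sum_(b in S) F a b = 0 by rewrite add0r.
  have anti : \sum_(a in S) \sum_(b in S) F a b = - \sum_(a in S) \sum_(b in S) F a b.
    rewrite {1}exchange_big /= -sumrN; apply: eq_bigr => a _; rewrite -sumrN.
    by apply: eq_bigr => b _; rewrite /F adj_sym; case: adj; rewrite ?oppr0 ?opprB.
  by lra.
rewrite pair_big_dep /= big_mkcond [RHS]big_mkcond; apply: eq_bigr => [[a b]] _.
by rewrite /F inE /=; case: (a \in S); case: (b \in S); case: adj.
Qed.

End Rows.

(** * Potentials along a bridge *)

Section Certificates.
Variables (R : realType) (n : nat).
Implicit Types (G : sgraph n) (a b c u v w f g : 'I_n).
Local Notation green := (@green R n).
Local Notation pot := (@pot R n).

Definition bridge G u v :=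
  adj (edges G) u v && ~~ conn (edges G :\ [set u; v]) u v.

Definition far_side G u v := [set a | conn (edges G :\ [set u; v]) v a].

Lemma harmonic_const E (Q : {pred 'I_n}) c (x : 'I_n -> R) :
  (forall a b, a \in Q -> b \notin Q -> adj E a b -> b = c) ->
  (forall a, a \in Q -> lapf E x a = 0) ->
  forall a, a \in Q -> conn E c a -> x a = x c.
Proof.
move=> bdQ xQ a aQ ca; apply/eqP; rewrite eq_le; apply/andP; split.
  by apply: (max_principle bdQ) => // b bQ; rewrite xQ.
rewrite -lerN2; apply: (@max_principle _ _ _ Q c (fun b => - x b)) ca => // b bQ.
by rewrite lapfN xQ // oppr0.
Qed.

Lemma mem_neq (A : {pred 'I_n}) a b : a \in A -> b \notin A -> (a == b) = false.
Proof. by move=> aA; apply: contraNF => /eqP <-. Qed.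

Section FarSide.
Variables (G : sgraph n) (u v : 'I_n).
Hypothesis uv : bridge G u v.
Local Notation E := (edges G).
Local Notation T := (far_side G u v).

Let adjuv : adj E u v. Proof. by case/andP: uv. Qed.

Lemma far_side_end : v \in T. Proof. by rewrite inE connect0. Qed.

Lemma far_side_start : u \notin T.
Proof. by case/andP: uv; rewrite inE conn_sym. Qed.

Lemma far_side_exit a b : a \in T -> b \notin T -> adj E a b -> a = v /\ b = u.
Proof.
move=> aT bT ab; case: (boolP (adj (E :\ [set u; v]) a b)) => [ab'|].
  by move: aT bT; rewrite !inE -(conn_adjr _ ab') => ->.
case/(adj_rem ab) => [[au _]|//]; by rewrite au (negbTE far_side_start) in aT.
Qed.

Lemma far_side_conn a : a \in T -> conn E u a.
Proof.
rewrite inE => va; apply: connect_trans (connect1 adjuv) _.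
by apply: conn_sub va; apply: subsetDl.
Qed.

Lemma far_side_conn_end a : a \in T -> conn E v a.
Proof. by rewrite inE; apply: conn_sub; apply: subsetDl. Qed.

(** The near side without [u] contains no terminal and can be left only to [u]. *)
Lemma pot_near f a : f \in T -> a \notin T -> conn E u a -> pot G u f a = pot G u f u.
Proof.
move=> fT aT ua; have [->//|au] := eqVneq a u.
apply: (@harmonic_const E [pred b | (b \notin T) && (b != u)]) => //; last by rewrite inE aT.
- move=> b c; rewrite !inE => /andP[bT bu]; rewrite negb_and !negbK => /orP[cT bc|/eqP//].
  have [] := @far_side_exit c b; rewrite ?inE //; first by rewrite adj_sym.
  by move=> _ bu'; rewrite bu' eqxx in bu.
- move=> b; rewrite !inE => /andP[bT /negbTE bu]; rewrite lapf_pot ?far_side_conn // bu.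
  have -> : (b == f) = false by apply: contraNF bT => /eqP->; rewrite inE in fT.
  by rewrite subrr.
Qed.

(** The near side is at the potential of [u], so the whole unit current leaves [u] through the
    bridge. *)
Lemma pot_bridge_end f : f \in T -> pot G u f v = pot G u f u - 1.
Proof.
move=> fT; have := lapf_pot R u (far_side_conn fT); rewrite eqxx.
rewrite eq_sym (mem_neq fT far_side_start).
rewrite subr0 /lapf (bigD1 v) //= big1 => [|b /andP[ub bv]]; first by lra.
rewrite pot_near ?connect1 ?subrr //; apply/negP => bT.
by have [bv' _] := far_side_exit bT far_side_start (etrans (adj_sym _ _ _) ub); rewrite bv' eqxx in bv.
Qed.

(** The only terminal in [T] is the sink, and [T] without [v] can be left only to [v]. *)
Lemma pot_far f a : f \in T -> a \in T -> pot G u f a <= pot G u f u - 1.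
Proof.
move=> fT aT; rewrite -pot_bridge_end //; have [->//|av] := eqVneq a v.
apply: (@max_principle _ _ E [pred b | (b \in T) && (b != v)]).
- move=> b c /andP[bT bv]; rewrite inE negb_and negbK => /orP[cT bc|/eqP//].
  by have [bv' _] := far_side_exit bT cT bc; rewrite bv' eqxx in bv.
- move=> b /andP[bT _]; rewrite lapf_pot ?far_side_conn //.
  rewrite (mem_neq bT far_side_start).
  by rewrite sub0r oppr_le0 ler0n.
- by rewrite inE aT.
- exact: far_side_conn_end.
Qed.

(** Neither terminal lies in [T], which can be left only to [u]. *)
Lemma pot_const_far f a : conn E u f -> f \notin T -> a \in T -> pot G u f a = pot G u f u.
Proof.
move=> uf fT aT; apply: (@harmonic_const E (mem T)) => //; last exact: far_side_conn.
  by move=> b c bT cT bc; have [] := far_side_exit bT cT bc.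
move=> b /= bT; rewrite lapf_pot //.
rewrite (mem_neq bT far_side_start).
rewrite (mem_neq bT fT).
by rewrite subrr.
Qed.

(** A current from [v] to [z] stays in [T], so [u] is at the potential of the source [v], which is
    positive. The potential at [u] is the difference of the two entries. *)
Lemma green_bridge_neq z : z \in T -> z != v -> green G u v != green G u z.
Proof.
move=> zT zv; have vz := far_side_conn_end zT.
have /eqP : pot G v z u = pot G v z v.
  apply: (@harmonic_const E [pred b | b \notin T]).
  - move=> b c; rewrite !inE => bT; rewrite negbK => cT bc.
    by have [] := @far_side_exit c b; rewrite ?inE // adj_sym.
  - move=> b; rewrite inE => bT; rewrite lapf_pot //.
    have -> : (b == v) = false by apply: contraNF bT => /eqP->; exact: far_side_end.
    have -> : (b == z) = false by apply: contraNF bT => /eqP->.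
    by rewrite subrr.
  - by rewrite inE far_side_start.
  - by rewrite conn_sym connect1.
apply: contraTneq => guv; have -> : pot G v z u = 0 by rewrite /pot guv subrr.
rewrite eq_sym.
by rewrite gt_eqF // pot_gt0 // eq_sym.
Qed.

End FarSide.

Lemma pot_conn_support G u f a : conn (edges G) u f -> pot G u f a != 0 -> conn (edges G) u a.
Proof. by move=> uf; apply: contraNT => ua; rewrite pot_outside. Qed.

Lemma adj_cut_pair1 G u w : adj (edges G) u w -> (u, w) \in cut_pairs (edges G) [set u].
Proof.
move=> uw; rewrite !inE /= eqxx uw andbT /=.
by apply: contraTneq uw => ->; rewrite adjxx.
Qed.

Lemma isolated_cut0 G u : cut_pairs (edges G) [set u] = set0 -> isolated G u.
Proof.
move=> c0; apply/forallP => w; apply/negP => /adj_cut_pair1.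
by rewrite c0 inE.
Qed.

Lemma lapf_cut1 G u (x : 'I_n -> R) :
  lapf (edges G) x u = \sum_(p in cut_pairs (edges G) [set u]) (x p.1 - x p.2).
Proof. by rewrite -flux big_set1. Qed.

Lemma sum_ge_card (I : finType) (P : {set I}) (F : I -> R) (c : R) k :
  (k <= #|P|)%N -> 0 <= c -> (forall i, i \in P -> c <= F i) ->
  c *+ k <= \sum_(i in P) F i.
Proof.
move=> kP c0 cF; apply: le_trans (_ : c *+ #|P| <= _); first by rewrite ler_wpMn2l.
by rewrite -sumr_const; apply: ler_sum.
Qed.

End Certificates.

(** * Graphs agreeing on a few rows *)

Section Soundness.
Variables (R : realType) (n : nat).
Implicit Types (G H : sgraph n) (a b c u v w f g : 'I_n).
Local Notation green := (@green R n).
Local Notation pot := (@pot R n).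

Lemma cut_pairs_nonempty E (S : {set 'I_n}) (x : 'I_n -> R) :
  \sum_(a in S) lapf E x a != 0 -> cut_pairs E S != set0.
Proof. by rewrite flux; apply: contraNneq => ->; rewrite big_set0. Qed.

(* A vertex of degree one spans a bridge. *)
Lemma cut1_ge2 H u : edge_biconnected H -> ~~ isolated H u ->
  (2 <= #|cut_pairs (edges H) [set u]|)%N.
Proof. by move=> Hb iu; apply: cut_pairs_ge2 => //; apply: contraNneq iu => /isolated_cut0. Qed.

Lemma lapf_green_disconn H u f : ~~ conn (edges H) u f -> u != f ->
  lapf (edges H) (pot H u f) u = 1 - (comp_size H u)%:R^-1.
Proof.
move=> nuf uf; rewrite /pot lapfB !lapf_green eqxx connect0 (negbTE uf).
by rewrite conn_sym (negbTE nuf) mul0r subrr subr0 mul1r.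
Qed.

Lemma pot_disconnl H u f a : ~~ conn (edges H) u f -> conn (edges H) u a ->
  pot H u f a = green H a u.
Proof.
move=> nuf ua; rewrite /pot [green H a f]green_disconn ?subr0 //.
by apply: contra nuf; apply: connect_trans.
Qed.

Lemma green_max H u a : conn (edges H) u a -> a != u -> green H a u < green H u u.
Proof.
move=> ua au; rewrite -subr_gt0 (green_sym R H a u).
by apply: (pot_gt0 R ua); rewrite eq_sym.
Qed.

Section Bridge.
Variables (G H : sgraph n) (u v f : 'I_n).
Hypotheses (uv : bridge G u v) (Hb : edge_biconnected H).
Local Notation T := (far_side G u v).
Hypothesis fT : f \in T.
Hypothesis eq_uf : forall a, pot H u f a = pot G u f a.

Let x := pot G u f.
Let C := [set a | conn (edges G) u a].
Let S := C :\: T.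

Let uS : u \in S. Proof. by rewrite in_setD (far_side_start uv) inE connect0. Qed.
Let uf : u != f. Proof. by rewrite eq_sym (mem_neq fT (far_side_start uv)). Qed.
Let cuf : conn (edges G) u f. Proof. exact: far_side_conn uv _ fT. Qed.
Let xu : 0 < x u. Proof. exact: pot_gt0. Qed.

Let cases a : [\/ a \in S /\ x a = x u, a \in T /\ x a <= x u - 1
   | [/\ a \notin S, a \notin T & x a = 0]].
Proof.
have [aT|aT] := boolP (a \in T).
  by apply: Or32; split=> //; exact: (pot_far R uv).
have [aC|aC] := boolP (conn (edges G) u a).
  by apply: Or31; split; [rewrite in_setD aT inE|exact: (pot_near R uv)].
apply: Or33; split=> //; first by rewrite in_setD aT inE.
exact: pot_outside.
Qed.

Let lapx a : lapf (edges H) x a = lapf (edges H) (pot H u f) a.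
Proof. by rewrite /lapf; apply: eq_bigr => b _; rewrite !eq_uf. Qed.

Let xS a : a \in S -> x a = x u.
Proof. by case: (cases a) => [[]|[aT]|[/negbTE->]] //; rewrite inE aT. Qed.

Let xT a : a \in T -> x a <= x u - 1.
Proof. by case: (cases a) => [[]|[]|[_ /negbTE->]] //; rewrite inE => /andP[/negbTE->]. Qed.

Let xnotS a : a \notin S -> x a <= Num.max 0 (x u - 1).
Proof.
by rewrite le_max; case: (cases a) => [[->]|[_ ->]|[_ _ ->]] //; rewrite ?lexx ?orbT.
Qed.

(** Were [f] elsewhere in [H], then on the [H]-component of [u] the function [x] would be a column
    of the pseudoinverse for [H], with a strict maximum at [u]; so [u] would be the only vertex of
    [S] there. Two edges at [u] carrying less than one unit force [x u < 1/2]. The other values are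
    nonpositive with sum [- x u], but a single one in [T] is at most [x u - 1], which is below
    that. *)
Lemma bridge_rows_conn : conn (edges H) u f.
Proof.
apply/negPn/negP => nuf.
have onC a : conn (edges H) u a -> x a = green H a u.
  by move=> ua; rewrite /x -eq_uf pot_disconnl.
have xuE : x u = green H u u by apply: onC; apply: connect0.
have niso : ~~ isolated H u.
  by apply/negP => /(green_isolated R) g0; move: xu; rewrite xuE g0 ltxx.
have only a : conn (edges H) u a -> a \in S -> a = u.
  move=> ua aS; apply/eqP/negPn/negP => au; have := green_max ua au.
  by rewrite -onC // -xuE xS // ltxx.
have drop b : adj (edges H) u b -> Num.min (x u) 1 <= x u - x b.
  move=> ub; have := @xnotS b; rewrite /Num.min /Num.max.
  have bS : b \notin S.
    by apply/negP => /(only _ (connect1 ub)) bu; rewrite bu adjxx in ub.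
  by move=> /(_ bS); case: ltP => h1; case: ltP => h2; lra.
have lap1 : lapf (edges H) x u < 1.
  by rewrite lapx lapf_green_disconn // ltrBlDr ltrDl invr_gt0 ltr0n comp_size_gt0.
have min0 : 0 <= Num.min (x u) 1 by rewrite le_min ltW //= ler01.
have := @sum_ge_card R _ (cut_pairs (edges H) [set u]) (fun p => x p.1 - x p.2) _ _
  (cut1_ge2 Hb niso) min0.
have all_p p : p \in cut_pairs (edges H) [set u] -> Num.min (x u) 1 <= x p.1 - x p.2.
  by rewrite !inE => /and3P[/eqP-> _]; apply: drop.
move=> /(_ all_p); rewrite -lapf_cut1 => minlap.
have xu2 : x u *+ 2 < 1.
  by move: minlap; rewrite /Num.min; case: ltP => h; lra.
have := sum_green R H u u; rewrite (bigD1 u) ?connect0 //= -xuE.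
rewrite (eq_bigr x); last by move=> a /andP[ua _]; rewrite onC.
move=> s0; have sneg : \sum_(a | conn (edges H) u a && (a != u)) x a < 0.
  by move: xu s0; lra.
have val a : conn (edges H) u a && (a != u) -> (a \in T) || (x a == 0).
  move=> /andP[ua au]; case: (cases a) => [[aS _]|[->]//|[_ _ ->]].
    by rewrite (only a ua aS) eqxx in au.
  by rewrite eqxx orbT.
have xTneg a : a \in T -> x a <= 0 by move/xT; lra.
have [/existsP[w /andP[Pw wT]]|/existsPn noT] :=
  boolP [exists w, (conn (edges H) u w && (w != u)) && (w \in T)].
  have : \sum_(a | conn (edges H) u a && (a != u)) x a <= x u - 1.
    rewrite (bigD1 w) //=; apply: le_trans (_ : x w + 0 <= _); last by rewrite addr0 xT.
    rewrite lerD2l; apply: sumr_le0 => a /andP[Pa _].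
    by case/orP: (val a Pa) => [/xTneg//|/eqP->].
  by move: s0 xu2; lra.
move: sneg; rewrite big1 ?ltxx // => a Pa.
by have := noT a; have := val a Pa; rewrite Pa /=; case: (a \in T) => //= /eqP.
Qed.

Lemma bridge_rows_half : [/\ x u = 2^-1, (1 < #|T|)%N -> exists2 a, a != u & x a = x u
  & exists a b, [/\ a \in T, b \notin C & adj (edges H) a b]].
Proof.
have cH := bridge_rows_conn.
have sumS (A : {set 'I_n}) : \sum_(a in A) lapf (edges H) x a = (u \in A)%:R - (f \in A)%:R.
  under eq_bigr do rewrite lapx lapf_pot //.
  have delta w : \sum_(a in A) (a == w)%:R = (w \in A)%:R :> R.
    rewrite big_mkcond (bigD1 w) //= eqxx big1 ?addr0; first by case: (w \in A).
    by move=> a /negbTE->; rewrite if_same.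
  by rewrite sumrB !delta.
have fS : f \notin S by rewrite in_setD fT.
have fluxS : \sum_(p in cut_pairs (edges H) S) (x p.1 - x p.2) = 1.
  by rewrite -flux sumS uS (negbTE fS) subr0.
have fluxT : \sum_(p in cut_pairs (edges H) T) (x p.1 - x p.2) = -1.
  by rewrite -flux sumS fT (negbTE (far_side_start uv)) sub0r.
have S2 : (2 <= #|cut_pairs (edges H) S|)%N.
  by apply: cut_pairs_ge2 => //; apply: (cut_pairs_nonempty (x := x)); rewrite flux fluxS oner_eq0.
have T2 : (2 <= #|cut_pairs (edges H) T|)%N.
  apply: cut_pairs_ge2 => //; apply: (cut_pairs_nonempty (x := x)).
  by rewrite flux fluxT oppr_eq0 oner_eq0.
have dropS p : p \in cut_pairs (edges H) S -> Num.min (x u) 1 <= x p.1 - x p.2.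
  rewrite inE => /and3P[aS bS _]; rewrite (xS aS); have := xnotS bS.
  by rewrite /Num.min /Num.max; case: ltP => h1; case: ltP => h2; lra.
have min0 : 0 < Num.min (x u) 1 by rewrite lt_min xu ltr01.
(* At least two edges of [H] leave [S] and share a unit of flux. *)
have xu2 : x u <= 2^-1.
  have := sum_ge_card S2 (ltW min0) dropS; rewrite fluxS /Num.min.
  by case: ltP => h; lra.
(* An edge from [S] to [T] would carry a full unit, leaving nothing for a second edge out of [S],
   whose drop is positive. *)
have noST a b : a \in S -> b \in T -> ~~ adj (edges H) a b.
  move=> aS bT; apply/negP => ab.
  have pS : (a, b) \in cut_pairs (edges H) S.
    by rewrite inE /= aS ab andbT in_setD bT.
  have : (0 < #|cut_pairs (edges H) S :\ (a, b)|)%N by move: S2; rewrite (cardsD1 (a, b)) pS.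
  case/card_gt0P => q; rewrite in_setD1 => /andP[nq qS].
  move: fluxS; rewrite (bigD1 (a, b)) //= (bigD1 q) /=; last first.
    by rewrite qS nq.
  have h1 : 1 <= x a - x b by rewrite (xS aS); have := xT bT; lra.
  have h2 : Num.min (x u) 1 <= x q.1 - x q.2 by apply: dropS.
  set s := \sum_(i | _) _; have : 0 <= s.
    apply: sumr_ge0 => p /andP[/andP[pS' _] _].
    exact: le_trans (ltW min0) (dropS p pS').
  by lra.
have outT p : p \in cut_pairs (edges H) T -> p.2 \notin C.
  rewrite inE => /and3P[aT bT ab]; apply/negP => bC.
  have bS : p.2 \in S by rewrite in_setD bT.
  by have := noST _ _ bS aT; rewrite adj_sym ab.
have out0 b : b \notin C -> x b = 0 by rewrite inE => ?; apply: pot_outside.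
(* Hence edges of [H] leaving [T] end outside [C], where [x] is zero. At least two of them share the
   unit of flux into [T], each with drop at least [1 - x u]. *)
have xu2' : 2^-1 <= x u.
  have dropT p : p \in cut_pairs (edges H) T -> 1 - x u <= - (x p.1 - x p.2).
    move=> pT; rewrite (out0 _ (outT p pT)); move: pT; rewrite inE => /and3P[aT _ _].
    by have := xT aT; lra.
  have h0 : 0 <= 1 - x u by lra.
  by have := sum_ge_card T2 h0 dropT; rewrite sumrN fluxT; lra.
have xuE : x u = 2^-1 by apply/eqP; rewrite eq_le xu2.
split=> // [T1|]; last first.
  have /card_gt0P[[a b] pT] : (0 < #|cut_pairs (edges H) T|)%N by apply: leq_trans T2.
  exists a, b; split; [|exact: (outT _ pT)|]; by move: pT; rewrite inE => /and3P[].
have TC : T \subset C by apply/subsetP => a aT; rewrite inE; apply: far_side_conn aT.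
(* In [G] the values on [C] sum to zero. Being [1/2] on [S] and at most [-1/2] on [T], they make [S]
   at least as large as [T], which yields a second vertex of [S]. *)
have sum0 : \sum_(a in S) x a + \sum_(a in T) x a = 0.
  rewrite -[RHS](sum_pot R G u f u) [RHS](bigID (mem T)) /= addrC.
  congr (_ + _); apply: eq_bigl => a; first by rewrite in_setD [a \in C]inE andbC.
  by rewrite andb_idl // => /(subsetP TC); rewrite inE.
have hS : \sum_(a in S) x a = #|S|%:R * 2^-1.
  rewrite (eq_bigr (fun=> 2^-1)); last by move=> a /xS->.
  by rewrite sumr_const mulr_natl.
have hT : \sum_(a in T) x a <= - (#|T|%:R * 2^-1).
  rewrite mulr_natl -mulNrn -sumr_const; apply: ler_sum => a /xT; rewrite xuE; lra.
have leTS : (#|T| <= #|S|)%N by rewrite -(ler_nat R); move: sum0 hS hT; lra.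
have : (0 < #|S :\ u|)%N by move: (leq_trans T1 leTS); rewrite (cardsD1 u) uS.
by case/card_gt0P => a; rewrite in_setD1 => /andP[au aS]; exists a => //; apply: xS.
Qed.

End Bridge.

(** There remains [x u = 1/2] with an edge [ab] of [H] from [T] to the outside of [C]. The row of a
    vertex [g] at the potential of [u] refutes it: [x_ug] attains its maximum throughout [T] and is
    harmonic at [a] in [H], yet vanishes at the neighbour [b]. *)
Lemma bridge_certificate G H u v f :
  bridge G u v -> edge_biconnected H -> f \in far_side G u v ->
  (1 < #|far_side G u v|)%N ->
  (forall a, pot H u f a = pot G u f a) ->
  (forall a, a != u -> pot G u f a = pot G u f u ->
     exists g, [/\ g != u, pot G u f g = pot G u f u & forall b, pot H g u b = pot G g u b]) ->
  False.
Proof.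
move=> uv Hb fT T1 eq_uf companion.
have [xu /(_ T1)[a0 a0u /(companion _ a0u)[g [gu xg eq_gu]]] [a [b [aT bC ab]]]] :=
  bridge_rows_half uv Hb fT eq_uf.
have cHuf := bridge_rows_conn uv Hb fT eq_uf.
have xg0 : pot G u f g != 0 by rewrite xg xu invr_eq0 pnatr_eq0.
have cGuf := far_side_conn uv fT.
have cGug := pot_conn_support cGuf xg0.
have cHug : conn (edges H) u g by apply: (@pot_conn_support R _ _ _ _ _ cHuf); rewrite eq_uf.
have gT : g \notin far_side G u v.
  by apply/negP => gT; have := pot_far R uv fT gT; rewrite xg; lra.
pose y := pot G u g.
have yH c : pot H u g c = y c by rewrite pot_opp eq_gu -pot_opp.
have yT c : c \in far_side G u v -> y c = y u by move=> cT; exact: (pot_const_far R uv cGug gT cT).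
have yu : 0 < y u by apply: pot_gt0 => //; rewrite eq_sym.
have yb : y b = 0 by apply: pot_outside => //; rewrite inE in bC.
have ymax c : y c <= y u.
  have [uc|nuc] := boolP (conn (edges G) u c); first exact: pot_max.
  by rewrite /y pot_outside // ltW.
have := lapf_pot R a cHug; rewrite (mem_neq aT (far_side_start uv)) (mem_neq aT gT) subrr.
rewrite /lapf (bigD1 b) //=; set s := \sum_(c | _) _ => s0.
have : 0 <= s by apply: sumr_ge0 => c _; rewrite !yH yT // subr_ge0.
by move: s0; rewrite !yH yb yT //; move: yu; lra.
Qed.

Definition K2_component G u v :=
  [/\ u != v, adj (edges G) u v, forall w, adj (edges G) u w -> w = v
    & forall w, adj (edges G) v w -> w = u].

Lemma K2_conn G u v w : K2_component G u v -> conn (edges G) u w = (w == u) || (w == v).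
Proof.
case=> uv auv hu hv; apply/idP/orP => [uw|[/eqP->|/eqP->]]; [|exact: connect0|exact: connect1].
apply/orP; apply: (conn_stable (P := fun a => (a == u) || (a == v))) uw _; last by rewrite eqxx.
by move=> c d /orP[]/eqP-> => [/hu|/hv] ->; rewrite eqxx ?orbT.
Qed.

Lemma K2_green G u v : K2_component G u v -> green G u u = 4^-1 /\ green G v u = - 4^-1.
Proof.
move=> k2; have [uv auv hu hv] := k2.
have sum2 (x : 'I_n -> R) : \sum_(w | conn (edges G) u w) x w = x u + x v.
  rewrite (eq_bigl (mem [set u; v])) => [|w]; last by rewrite !inE (K2_conn _ k2).
  by rewrite big_setU1 ?big_set1 // inE.
have s1 := sum_green R G u u; have s2 := sum_green R G u v; rewrite !sum2 in s1 s2.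
have := lapf_pot R u (connect1 auv); rewrite /lapf (big_pred1 v) => [|w]; last first.
  by apply/idP/eqP => [/hu|->].
rewrite eqxx (negbTE uv) subr0 /pot; move: s1 s2; rewrite (green_sym R G u v).
rewrite (_ : true%:R = 1 :> R) // => s1 s2 s3.
by split; lra.
Qed.

Lemma K2_certificate G H u v u' v' :
  K2_component G u v -> K2_component G u' v' -> u' != u -> u' != v ->
  edge_biconnected H -> (forall a, pot H u u' a = pot G u u' a) -> False.
Proof.
move=> k2 k2' uu' vu' Hb eqp.
have [guu gvu] := K2_green k2; have [guu' gvu'] := K2_green k2'.
have [uv auv hu hv] := k2; have [uv' auv' hu' hv'] := k2'.
have nuu' : ~~ conn (edges G) u u' by rewrite (K2_conn _ k2) negb_or uu'.
have disc a b : conn (edges G) u a -> conn (edges G) u' b -> green G a b = 0.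
  move=> ua ub; apply: green_disconn; apply: contra nuu' => ab.
  apply: connect_trans ua (connect_trans ab _); by rewrite conn_sym.
have Cv : conn (edges G) u v by apply: connect1.
have Cv' : conn (edges G) u' v' by apply: connect1.
pose x := pot G u u'.
have xu : x u = 4^-1 by rewrite /x /pot guu disc ?connect0 ?subr0.
have xv : x v = - 4^-1 by rewrite /x /pot gvu disc ?connect0 ?subr0.
have xu' : x u' = - 4^-1.
  by rewrite /x /pot guu' green_sym disc ?connect0 ?sub0r.
have xv' : x v' = 4^-1.
  by rewrite /x /pot gvu' green_sym disc ?connect0 ?sub0r ?opprK.
have x0 a : a != u -> a != v -> a != u' -> a != v' -> x a = 0.
  move=> n1 n2 n3 n4; rewrite /x /pot !green_disconn ?subr0 //; rewrite conn_sym.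
    by rewrite (K2_conn _ k2') negb_or n3.
  by rewrite (K2_conn _ k2) negb_or n1.
have vu : v' != u.
  apply: contraNneq nuu' => <-; rewrite conn_sym; exact: Cv'.
have xle a : x a <= 4^-1.
  have [->|n1] := eqVneq a u; first by rewrite xu.
  have [->|n2] := eqVneq a v; first by rewrite xv; lra.
  have [->|n3] := eqVneq a u'; first by rewrite xu'; lra.
  have [->|n4] := eqVneq a v'; first by rewrite xv'.
  by rewrite x0 //; lra.
have xge a : a != v -> a != u' -> 0 <= x a.
  move=> n2 n3; have [->|n1] := eqVneq a u; first by rewrite xu; lra.
  have [->|n4] := eqVneq a v'; first by rewrite xv'; lra.
  by rewrite x0.
have only a : x a = 4^-1 -> (a == u) || (a == v').
  move=> xa; apply/negPn/negP; rewrite negb_or => /andP[n1 n4].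
  have [e|n2] := eqVneq a v; first by move: xa; rewrite e xv; lra.
  have [e|n3] := eqVneq a u'; first by move: xa; rewrite e xu'; lra.
  by move: xa; rewrite x0 //; lra.
have v'u' : v' != u' by rewrite eq_sym.
(* If [H] joins [u] and [u'], then [v'] is a harmonic maximum, so its neighbours also have value
   [1/4]. Only [u] qualifies, but at least two edges meet [v']. *)
have [cuu'|ncuu'] := boolP (conn (edges H) u u').
  have cv' : conn (edges H) u v'.
    apply: (@pot_conn_support R _ _ _ _ _ cuu'); rewrite eqp -/(x v') xv'; lra.
  have niso : ~~ isolated H v'.
    apply/negP => iv; have e := conn_isolated iv (etrans (conn_sym _ _ _) cv').
    by rewrite e eqxx in vu.
  have := cut1_ge2 Hb niso; rewrite (cardsD1 (v', u)) => c2.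
  have : (0 < #|cut_pairs (edges H) [set v'] :\ (v', u)|)%N by move: c2; case: ((v', u) \in _) => // /ltnW.
  case/card_gt0P => [[p b]]; rewrite in_setD1 => /andP[nb]; rewrite !inE /=.
  case/and3P=> /eqP ep bv' pb; rewrite ep in pb nb.
  have := lapf_pot R v' cuu'; rewrite (negbTE vu) (negbTE v'u') subrr => /eqP.
  rewrite /lapf psumr_eq0 => [|c _]; last by rewrite !eqp -!/(x _) xv' subr_ge0.
  move/allP/(_ b (mem_index_enum _)); rewrite pb /= !eqp -!/(x _) xv' subr_eq0 => /eqP/esym/only.
  by case/orP => /eqP e; [rewrite e eqxx in nb | rewrite e eqxx in bv'].
(* Otherwise [x] is a column of the pseudoinverse on the [H]-component of [u], and minus such a
   column on that of [u']. As these have strict maxima, [v] lies in the component of [u] and [v']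
   does not. *)
have onC a : conn (edges H) u a -> x a = green H a u.
  by move=> ua; rewrite /x -eqp pot_disconnl.
have cv : conn (edges H) u v.
  apply/negPn/negP => ncv.
  have cv : conn (edges H) u' v.
    apply/negPn/negP => ncv'; have : x v = 0.
      by rewrite /x -eqp /pot !green_disconn ?subrr // conn_sym.
    by rewrite xv; lra.
  have : green H v u' < green H u' u' by apply: green_max => //; rewrite eq_sym.
  have e a : conn (edges H) u' a -> x a = - green H a u'.
    by move=> ua; rewrite /x -eqp pot_opp pot_disconnl // conn_sym.
  by rewrite -[green H v u']opprK -[green H u' u']opprK -!e ?connect0 // xv xu' ltxx.
have niso : ~~ isolated H v.
  apply/negP => iv; have e := conn_isolated iv (etrans (conn_sym _ _ _) cv).
  by rewrite e eqxx in uv.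
have nv' : ~~ conn (edges H) u v'.
  by apply/negP => cv'; have := green_max cv' vu; rewrite -!onC ?connect0 // xu xv' ltxx.
have xn a : conn (edges H) u a -> a != v -> 0 <= x a.
  by move=> ua av; apply: xge => //; apply: contraNneq ncuu' => <-.
have lapv : lapf (edges H) x v = - (comp_size H u)%:R^-1.
  transitivity (lapf (edges H) (pot H u u') v).
    by rewrite /lapf; apply: eq_bigr => b _; rewrite !eqp.
  rewrite /pot lapfB !lapf_green cv eq_sym (negbTE uv) (_ : v == u' = false); last by rewrite eq_sym; apply/negbTE.
  have -> : conn (edges H) u' v = false.
    by apply: contraNF ncuu' => u'v'; apply: connect_trans cv _; rewrite conn_sym.
  by rewrite mul0r mul1r !sub0r oppr0 subr0.
(* In this component only [v] is negative, so each of its two or more edges carries at least [1/4],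
   while the inflow is the reciprocal of the component size. The size is then at most two, against
   [v] and two neighbours. *)
have := @sum_ge_card R _ (cut_pairs (edges H) [set v]) (fun p => x p.2 - x p.1) 4^-1 2
  (cut1_ge2 Hb niso).
have inv4 : (0 : R) <= 4^-1 by rewrite invr_ge0 ler0n.
have nbr p : p \in cut_pairs (edges H) [set v] -> 4^-1 <= x p.2 - x p.1.
  case: p => a b; rewrite !inE /= => /and3P[/eqP-> bv vb].
  have := xn b (connect_trans cv (connect1 vb)) bv; rewrite xv; lra.
move/(_ inv4 nbr); have -> : \sum_(p in cut_pairs (edges H) [set v]) (x p.2 - x p.1) =
    - lapf (edges H) x v.
  by rewrite lapf_cut1 -sumrN; apply: eq_bigr => p _; ring.
rewrite lapv opprK => half.
have : (2 < comp_size H u)%N.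
  apply: leq_trans (_ : #|v |: [set p.2 | p in cut_pairs (edges H) [set v]]| <= _)%N.
    rewrite cardsU1; have -> : v \notin [set p.2 | p in cut_pairs (edges H) [set v]].
      by apply/imsetP => [[[a b]]]; rewrite !inE /= => /and3P[_ bv _] e; rewrite -e eqxx in bv.
    rewrite ltnS card_in_imset; first exact: cut1_ge2.
    move=> [a b] [c d]; rewrite !inE /= => /and3P[/eqP-> _ _] /and3P[/eqP-> _ _].
    by move=> ->.
  apply: subset_leq_card; apply/subsetP => b; rewrite !inE => /orP[/eqP->//|].
  case/imsetP => [[a c]]; rewrite !inE /= => /and3P[/eqP-> _ vc ->].
  exact: connect_trans cv (connect1 vc).
rewrite -(ltr_nat R) => big.
have k0 : 0 < (comp_size H u)%:R :> R by rewrite ltr0n comp_size_gt0.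
by have := ler_wpM2l (ltW k0) half; rewrite mulfV ?gt_eqF //; lra.
Qed.

End Soundness.

(** * Exploring the component of a vertex *)

Section Exploration.
Variables (R : realType) (n : nat).
Implicit Types (G H : sgraph n) (a b c u v w f g : 'I_n) (X : seq 'I_n).
Local Notation row := {ffun 'I_n -> R}.
Local Notation pot := (@pot R n).

(* Vertices whose potentials tell [u] from every sampled vertex; they lie in the
   component of [u] as soon as the other samples meet two components or its own. *)
Definition candidates (u : 'I_n) (ru : row) (kx : seq ('I_n * row)) : {set 'I_n} :=
  [set a | (a != u) && all (fun p => (p.1 == u) || (rdiff ru p.2 a != 0)) kx].

(* The vertices that [u] separates from [f], by additivity of the resistance. *)
Definition separated (u : 'I_n) (ru rf : row) (A : {set 'I_n}) : {set 'I_n} :=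
  [set a in A | rf a == rf u + ru a].

(** Supplies the vertex [g] of [bridge_certificate] whenever there is one; the default [u] stands
    for none. *)
Definition companion (u : 'I_n) (ru rf : row) : 'I_n :=
  odflt u [pick g | (g != u) && (rdiff ru rf g == rdiff ru rf u)].

Fixpoint picks (rw : 'I_n -> row) u t (A : {set 'I_n}) : seq 'I_n :=
  if t is t'.+1 then
    if [pick f in A] is Some f then f :: picks rw u t' (separated u (rw u) (rw f) A)
    else [::]
  else [::].

(** Which sample or pick lies beyond a bridge is not known, so a companion is read for each. *)
Definition probe (rw : 'I_n -> row) t X u : seq 'I_n :=
  let P := picks rw u t (candidates u (rw u) [seq (f, rw f) | f <- X]) in
  P ++ [seq companion u (rw u) (rw f) | f <- X ++ P].

Definition visited (rw : 'I_n -> row) t X : seq 'I_n :=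
  X ++ flatten [seq probe rw t X u | u <- X].

Section Picks.
Variables (G : sgraph n) (u : 'I_n).
Local Notation E := (edges G).
Local Notation rw := (@resrow R n G).

(** In the additivity of resistances the diagonal entries at [a] and [f] cancel; what is left says
    that [a] is at the potential of [u] for the current from [f] to [u]. *)
Lemma separatedE f A a : (a \in separated u (rw u) (rw f) A) =
  (a \in A) && (pot G f u a == pot G f u u).
Proof.
rewrite inE !ffunE !eff_resE /pot; congr (_ && _); rewrite (green_sym R G u a) (green_sym R G f a).
rewrite (green_sym R G f u).
by apply/eqP/eqP => h; lra.
Qed.

Lemma pot_sink_min f a : conn E u f -> conn E u a -> pot G f u u <= pot G f u a.
Proof. by move=> uf ua; rewrite pot_opp [leRHS]pot_opp lerN2 pot_max. Qed.

Lemma pot_sink_neq f : conn E u f -> f != u -> pot G f u f != pot G f u u.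
Proof.
move=> uf fu; rewrite gt_eqF //; apply: (@lt_trans _ _ 0).
  by rewrite pot_opp oppr_lt0 pot_gt0 // eq_sym.
by rewrite pot_gt0 // conn_sym.
Qed.

(** The vertices above the potential of [u], for the current from [f], can be left only to [u]:
    another vertex at the minimum is harmonic, so all its neighbours are at the minimum. As [f'] is
    not among them, the current from [f'] is constant there. *)
Lemma pot_separated f f' b : conn E u f -> f != u -> conn E u f' ->
  pot G f u f' = pot G f u u -> conn E u b -> pot G f u b != pot G f u u ->
  pot G f' u b = pot G f' u u.
Proof.
move=> uf fu uf' sep ub nb.
apply: (@harmonic_const R n E [pred a | conn E u a && (pot G f u a != pot G f u u)]) => //.
- move=> a c /andP[ua na] nc ac; apply/eqP/negPn/negP => cu.
  have uc : conn E u c by rewrite -(conn_adjr _ ac).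
  move: nc; rewrite inE uc /= negbK => /eqP yc.
  have cf : c != f.
    by apply: contraNneq (pot_sink_neq uf fu) => e; rewrite -yc e.
  have := lapf_pot R c (etrans (conn_sym _ _ _) uf); rewrite (negbTE cf) (negbTE cu) subrr.
  move/(congr1 -%R)/eqP; rewrite oppr0 -lapfN /lapf psumr_eq0; last first.
    move=> d cd; rewrite opprK addrC subr_ge0 yc; apply: pot_sink_min => //.
    by rewrite -(conn_adjr _ cd).
  move/allP/(_ a (mem_index_enum _)); rewrite adj_sym ac /= opprK addrC subr_eq0 yc => /eqP ya.
  by rewrite ya eqxx in na.
- move=> a /andP[ua na]; rewrite lapf_pot; last by rewrite conn_sym.
  have -> : (a == f') = false by apply: contraNF na => /eqP->; rewrite sep.
  have -> : (a == u) = false by apply: contraNF na => /eqP->.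
  by rewrite subrr.
- by rewrite inE ub.
Qed.

Lemma picks_sub t (A : {set 'I_n}) : {subset picks rw u t A <= A}.
Proof.
elim: t A => [|t IH] A //= f; case: pickP => [g gA|//]; rewrite inE => /orP[/eqP->//|].
by move/IH; rewrite inE => /andP[].
Qed.

Lemma picks_pairwise t (A : {set 'I_n}) :
  pairwise (fun f f' => pot G f u f' == pot G f u u) (picks rw u t A).
Proof.
elim: t A => [|t IH] A //=; case: pickP => [g gA|//] /=; rewrite IH andbT.
by apply/allP => f /picks_sub; rewrite separatedE => /andP[].
Qed.

(** Each pick [f] is charged to a neighbour [nb f] through which its current enters [u]. For a later
    pick, [pot_separated] puts [nb f] at the potential of [u], so the charging is injective. *)
Lemma picks_size_degree t (A : {set 'I_n}) : (forall a, a \in A -> conn E u a && (a != u)) ->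
  (size (picks rw u t A) <= degree G u)%N.
Proof.
move=> AC; pose nb f := odflt u [pick b | adj E u b && (pot G f u b != pot G f u u)].
have nbP f : f \in picks rw u t A ->
    adj E u (nb f) && (pot G f u (nb f) != pot G f u u).
  move/picks_sub/AC => /andP[uf fu]; rewrite /nb; case: pickP => //= none.
  have := lapf_pot R u (etrans (conn_sym _ _ _) uf); rewrite eqxx eq_sym (negbTE fu) sub0r.
  rewrite /lapf big1 => [/eqP|b ub]; first by rewrite eq_sym oppr_eq0 oner_eq0.
  by move: (none b); rewrite ub /= => /negbFE/eqP->; rewrite subrr.
rewrite -(size_map nb) /degree cardE; apply: uniq_leq_size.
  rewrite uniq_pairwise pairwise_map.
  apply: (sub_in_pairwise (P := mem (picks rw u t A))) (picks_pairwise t A); last exact/allP.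
  move=> f f' fP f'P /= /eqP sep; apply/eqP => nbe.
  have /andP[uf fu] := AC _ (picks_sub fP); have /andP[uf' _] := AC _ (picks_sub f'P).
  have /andP[ub nbf] := nbP f fP; have /andP[_] := nbP f' f'P.
  by rewrite -nbe (pot_separated uf fu uf' sep (connect1 ub) nbf) eqxx.
by move=> b /mapP[f /nbP/andP[ub _] ->]; rewrite mem_enum inE.
Qed.

(** A pick outside [T] is separated by [u] from all of [T], so members of [T] are never discarded
    and the picks do not run out. Missing [T] would take [t] picks, more than the degree allows. *)
Lemma picks_reach v t (A : {set 'I_n}) : bridge G u v -> (degree G u < t)%N ->
  (forall a, a \in A -> conn E u a && (a != u)) ->
  (exists2 a, a \in A & a \in far_side G u v) ->
  exists2 f, f \in picks rw u t A & f \in far_side G u v.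
Proof.
move=> uv dt AC meet; suff [//|full] :
    (exists2 f, f \in picks rw u t A & f \in far_side G u v) \/ size (picks rw u t A) = t.
  by have := picks_size_degree t AC; rewrite full leqNgt dt.
elim: {dt} t A AC meet => [|t IH] A AC [a aA aT] /=; first by right.
case: pickP => [f fA|/(_ a)]; last by rewrite aA.
have [fT|fT] := boolP (f \in far_side G u v); first by left; exists f; rewrite ?mem_head.
have /andP[uf fu] := AC _ fA.
case: (IH (separated u (rw u) (rw f) A)) => [b|||sz]; last by right; rewrite /= sz.
- by rewrite inE => /andP[/AC].
- exists a => //; rewrite separatedE aA /= pot_opp (pot_const_far R uv uf fT aT).
  by rewrite -pot_opp.
- by case=> g gP gT; left; exists g => //; rewrite inE gP orbT.
Qed.

End Picks.

Definition agree G H X := forall w, w \in X -> resrow R H w = resrow R G w.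

Lemma agree_pot G H X u f : agree G H X -> u \in X -> f \in X ->
  forall a, pot H u f a = pot G u f a.
Proof. by move=> GH uX fX a; rewrite -!rdiffE !GH. Qed.

(** The condition on vertices outside the component of [u] makes them fail the candidate test:
    [x_uf] vanishes there for the sampled [f] it provides. *)
Lemma explore_bridge G H t X u v :
  bridge G u v -> (1 < #|far_side G u v|)%N -> (degree G u < t)%N -> u \in X ->
  (forall a, ~~ conn (edges G) u a ->
     exists f, [/\ f \in X, f != u & ~~ conn (edges G) f a]) ->
  edge_biconnected H -> agree G H (visited (resrow R G) t X) -> False.
Proof.
move=> uv T1 dt uX spread Hb GH; set rw := resrow R G in GH.
set kx := [seq (f, rw f) | f <- X]; set A := candidates u (rw u) kx.
have XV w : w \in X -> w \in visited rw t X by move=> wX; rewrite mem_cat wX.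
have PV w : w \in probe rw t X u -> w \in visited rw t X.
  move=> wP; rewrite mem_cat; apply/orP; right; apply/flattenP.
  by exists (probe rw t X u) => //; apply/mapP; exists u.
have candE a : (a \in A) = (a != u) && all (fun f => (f == u) || (pot G u f a != 0)) X.
  rewrite inE all_map; congr (_ && _); apply: eq_all => f /=.
  by rewrite rdiffE.
suff [f fXP fT] : exists2 f, f \in X ++ picks rw u t A & f \in far_side G u v.
  have fV : f \in visited rw t X.
    move: fXP; rewrite mem_cat => /orP[/XV//|fP]; apply: PV.
    by rewrite /probe mem_cat fP.
  have gV : companion u (rw u) (rw f) \in visited rw t X.
    apply: PV; rewrite /probe mem_cat; apply/orP; right.
    by apply/mapP; exists f.
  apply: (bridge_certificate uv Hb fT T1); first exact: agree_pot GH (XV _ uX) fV.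
  move=> a au ea; exists (companion u (rw u) (rw f)).
  have [gu ge] : companion u (rw u) (rw f) != u /\
      pot G u f (companion u (rw u) (rw f)) = pot G u f u.
    rewrite /companion; case: pickP => [g /andP[gu]|/(_ a)] /=; rewrite !rdiffE.
      by move/eqP.
    by rewrite au ea eqxx.
  by split=> //; exact: agree_pot GH gV (XV _ uX).
have [/hasP[f fX fT]|noT] := boolP (has (mem (far_side G u v)) X).
  by exists f; rewrite // mem_cat fX.
suff [f fP fT] : exists2 f, f \in picks rw u t A & f \in far_side G u v.
  by exists f; rewrite // mem_cat fP orbT.
apply: picks_reach => // [a|].
  rewrite candE => /andP[au /allP Xa]; rewrite au andbT.
  apply/negPn/negP => nua; have [f [fX fu nfa]] := spread a nua.
  have := Xa f fX; rewrite (negbTE fu) /= /pot.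
  by rewrite !green_disconn ?subrr ?eqxx // conn_sym.
(* For [f] in another component [x_uf(a)] is [g(a,u)], so a candidate in [T] needs this to be
   nonzero. Since [g(_,u)] differs at [v] and [z], one of them will do. *)
have [z zT zv] : exists2 z, z \in far_side G u v & z != v.
  have : (0 < #|far_side G u v :\ v|)%N.
    by move: T1; rewrite (cardsD1 v) far_side_end.
  by case/card_gt0P => z; rewrite in_setD1 => /andP[zv zT]; exists z.
have [a aT ga] : exists2 a, a \in far_side G u v & green R G a u != 0.
  have := green_bridge_neq R uv zT zv; rewrite green_sym [X in _ != X]green_sym => gneq.
  have [gv|gv] := eqVneq (green R G v u) 0; last by exists v => //; exact: far_side_end.
  by exists z => //; rewrite -gv eq_sym.
exists a => //; rewrite candE (mem_neq aT (far_side_start uv)) /=.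
apply/allP => f fX; have [//|fu] := eqVneq f u; rewrite /=.
have fT : f \notin far_side G u v by move/hasPn: noT => /(_ f fX).
have [uf|nuf] := boolP (conn (edges G) u f).
  rewrite (pot_const_far R uv uf fT aT) gt_eqF //; apply: pot_gt0 => //.
  by rewrite eq_sym.
by rewrite pot_disconnl //; exact: far_side_conn aT.
Qed.

End Exploration.

(** * Counting bridge endpoints *)

Section Targets.
Variable n : nat.
Implicit Types (G H : sgraph n) (a b c u v w f t h : 'I_n) (X : seq 'I_n).

Definition deep_bridge G u := [exists v, bridge G u v && (1 < #|far_side G u v|)%N].

Definition K2b G u v := [&& adj (edges G) u v, [forall w, adj (edges G) u w ==> (w == v)]
  & [forall w, adj (edges G) v w ==> (w == u)]].

(* One vertex per [K2] component, so that distinct targets never share one. *)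
Definition K2_min G u := [exists v : 'I_n, (u < v)%N && K2b G u v].

(** A degree below [s] ensures that [s] picks reach the far side. *)
Definition targets s G : {set 'I_n} :=
  [set u | (degree G u < s)%N && (deep_bridge G u || K2_min G u)].

Definition touched G : {set 'I_n} := [set u | [exists v, bridge G u v]].

Lemma K2bP G u v : K2b G u v -> K2_component G u v.
Proof.
case/and3P => uv /forallP hu /forallP hv; split=> //.
- by apply: contraTneq uv => <-; rewrite adjxx.
- by move=> w uw; apply/eqP; have := hu w; rewrite uw.
- by move=> w vw; apply/eqP; have := hv w; rewrite vw.
Qed.

(** If the condition of [explore_bridge] fails at [u], all samples but [u] share one component; then
    [w] lies in the component of [u'] and meets the condition at [u']. *)
Lemma two_deep_hits (R : realType) G H s X u u' w :
  u \in X -> u' \in X -> w \in X -> u' != u -> w != u -> w != u' ->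
  (degree G u < s)%N -> (degree G u' < s)%N -> deep_bridge G u -> deep_bridge G u' ->
  edge_biconnected H -> agree R G H (visited (@resrow R n G) s X) -> False.
Proof.
move=> uX u'X wX u'u wu wu' du du' /existsP[v /andP[uv Tv]] /existsP[v' /andP[uv' Tv']] Hb GH.
have [/'forall_implyP sp|] := boolP [forall a, ~~ conn (edges G) u a ==>
    has (fun f => (f != u) && ~~ conn (edges G) f a) X].
  apply: (explore_bridge uv Tv du uX) Hb GH => a /sp/hasP[f fX /andP[fu fa]].
  by exists f.
rewrite negb_forall => /existsP[a]; rewrite negb_imply => /andP[nua /hasPn all_a].
have conn_a f : f \in X -> f != u -> conn (edges G) f a.
  by move=> fX fu; have := all_a f fX; rewrite fu negbK.
apply: (explore_bridge uv' Tv' du' u'X) Hb GH => b nb; exists w; split=> //.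
apply: contra nb => wb; apply: connect_trans (conn_a u' u'X u'u) _.
by apply: connect_trans wb; rewrite conn_sym conn_a.
Qed.

Lemma two_K2_hits (R : realType) G H s X u u' :
  u \in X -> u' \in X -> u' != u -> K2_min G u -> K2_min G u' ->
  edge_biconnected H -> agree R G H (visited (@resrow R n G) s X) -> False.
Proof.
move=> uX u'X u'u /existsP[v /andP[ltuv /K2bP k2]] /existsP[v' /andP[ltuv' /K2bP k2']] Hb GH.
apply: (K2_certificate k2 k2' u'u _ Hb).
  apply/eqP => e; have [_ _ _ hv] := k2; have [_ auv' _ _] := k2'.
  have e' : v' = u by apply: hv; rewrite -e.
  by move: ltuv'; rewrite e' e ltnNge ltnW.
by apply: agree_pot GH _ _; rewrite /visited mem_cat ?uX ?u'X.
Qed.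

(** Two of the three are of the same kind; for two deep bridges the third vertex serves as [w]. *)
Lemma three_hits (R : realType) G H s X u1 u2 u3 :
  u1 \in X -> u2 \in X -> u3 \in X -> u1 != u2 -> u1 != u3 -> u2 != u3 ->
  u1 \in targets s G -> u2 \in targets s G -> u3 \in targets s G ->
  edge_biconnected H -> agree R G H (visited (@resrow R n G) s X) -> False.
Proof.
move=> X1 X2 X3 n12 n13 n23; rewrite !inE => /andP[d1 k1] /andP[d2 k2] /andP[d3 k3] Hb GH.
have n21 : u2 != u1 by rewrite eq_sym.
have n31 : u3 != u1 by rewrite eq_sym.
have n32 : u3 != u2 by rewrite eq_sym.
case/orP: k1 => k1; case/orP: k2 => k2; case/orP: k3 => k3.
- exact: (two_deep_hits X1 X2 X3) Hb GH.
- exact: (two_deep_hits X1 X2 X3) Hb GH.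
- exact: (two_deep_hits X1 X3 X2) Hb GH.
- exact: (two_K2_hits X2 X3) Hb GH.
- exact: (two_deep_hits X2 X3 X1) Hb GH.
- exact: (two_K2_hits X1 X3) Hb GH.
- exact: (two_K2_hits X1 X2) Hb GH.
- exact: (two_K2_hits X1 X2) Hb GH.
Qed.

(** * Destroying all bridges with two hubs *)

Lemma detour G a b c : adj (edges G) a b -> adj (edges G) a c -> adj (edges G) c b ->
  ~ cut_edge G [set a; b].
Proof.
move=> ab ac cb; move/(cut_edgeP ab)/negP; apply.
have ca : c != a by apply: contraTneq ac => ->; rewrite adjxx.
have nb : c != b by apply: contraTneq cb => ->; rewrite adjxx.
have cN : c \notin [set a; b] by rewrite !inE negb_or ca.
apply: (@connect_trans _ _ c); apply: connect1; rewrite /adj in_setD1; apply/andP; split=> //.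
  by apply: contraNneq cN => <-; rewrite set22.
by apply: contraNneq cN => <-; rewrite set21.
Qed.

Lemma cut_edge_touched G u v : adj (edges G) u v -> cut_edge G [set u; v] -> u \in touched G.
Proof.
by move=> uv /(cut_edgeP uv) nuv; rewrite inE; apply/existsP; exists v; rewrite /bridge uv.
Qed.

Lemma cut_edge_sub G H e : edges G \subset edges H -> e \in edges G ->
  cut_edge H e -> cut_edge G e.
Proof.
move=> sGH /edgeP[u [v [-> uv adjuv]]].
have adjH : adj (edges H) u v by apply: (subsetP sGH).
move/(cut_edgeP adjH) => nH; apply/(cut_edgeP adjuv); apply: contra nH.
by apply: conn_sub; apply: setSD.
Qed.

Lemma touched_not_biconnected G : touched G = set0 -> edge_biconnected G.
Proof.
move=> t0 e ce; have [/edgeP[u [v [def_e _ uv]]] _] := ce; rewrite def_e in ce.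
by have := cut_edge_touched uv ce; rewrite t0 inE.
Qed.

Section Hubs.
Variables (G : sgraph n) (x y t : 'I_n).
Hypotheses (xy : x != y) (xt : x != t) (yt : y != t).

Let T := [set x; y; t] :|: touched G.
Let spokes h := [set [set w; h] | w in T :\ h].
Let EH := edges G :|: (spokes x :|: spokes y).

Let spokesP h w : w \in T -> w != h -> [set w; h] \in spokes h.
Proof. by move=> wT wh; apply/imsetP; exists w; rewrite // in_setD1 wh. Qed.

Let EH_card2 e : e \in EH -> #|e| = 2%N.
Proof.
rewrite !inE => /or3P[/edges_card2//||] /imsetP[w]; rewrite in_setD1 => /andP[wh _] ->;
  by rewrite cards2 wh.
Qed.

Let H := SGraph EH_card2.

Let adjHx w : w \in T -> w != x -> adj (edges H) w x.
Proof. by move=> wT wx; rewrite /adj !inE spokesP ?orbT. Qed.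

Let adjHy w : w \in T -> w != y -> adj (edges H) w y.
Proof. by move=> wT wx; rewrite /adj !inE spokesP ?orbT. Qed.

(** The triangle over a spoke uses the other hub, or [t] when the spoke joins the two hubs. *)
Let hub_edge h h' w : h != h' -> t != h -> t != h' -> h' \in T ->
  (forall w, w \in T -> w != h -> adj (edges H) w h) ->
  (forall w, w \in T -> w != h' -> adj (edges H) w h') ->
  w \in T -> w != h -> ~ cut_edge H [set w; h].
Proof.
move=> hh' th th' h'T ah ah' wT wh; have tT : t \in T by rewrite !inE eqxx !orbT.
have [e|wh'] := eqVneq w h'.
  apply: (@detour H w h t); rewrite ?ah //; first by rewrite adj_sym e ah'.
by apply: (@detour H w h h'); rewrite ?ah ?ah' // eq_sym.
Qed.

(** Old bridges that are not spokes lie in triangles with [x], since both ends are touched; spokes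
    are covered by [hub_edge]. *)
Lemma hubs : exists H : sgraph n, [/\ edges G \subset edges H, edge_biconnected H
  & (#|edges H :\: edges G| <= 2 * (#|touched G| + 3))%N].
Proof.
exists H; split; first exact: subsetUl.
  have xT : x \in T by rewrite !inE eqxx.
  have yT : y \in T by rewrite !inE eqxx orbT.
  have spoke e : e \in spokes x :|: spokes y -> ~ cut_edge H e.
    rewrite inE => /orP[]/imsetP[w]; rewrite in_setD1 => /andP[wh wT ->].
      by apply: (@hub_edge x y) => //; rewrite eq_sym.
    by apply: (@hub_edge y x) => //; rewrite eq_sym.
  move=> e ce; have [eH _] := ce; have [/spoke//|eS] := boolP (e \in spokes x :|: spokes y).
  have eG : e \in edges G by move: eH; rewrite [_ \in EH]in_setU (negbTE eS) orbF.
  have := cut_edge_sub (subsetUl _ _ : edges G \subset edges H) eG ce.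
  have [u [v [def_e uv auv]]] := edgeP eG; rewrite def_e => cG.
  have uT : u \in T by rewrite in_setU (cut_edge_touched auv cG) orbT.
  have vT : v \in T.
    rewrite in_setU (@cut_edge_touched G v u) ?orbT //; first by rewrite adj_sym.
    by rewrite setUC.
  have nx w w' : w \in T -> e = [set w; w'] -> w != w' -> w' != x.
    move=> wT e' ww'; apply: contraNneq eS => w'x; rewrite in_setU e' -w'x spokesP //.
  have ux : u != x by apply: (nx v) => //; rewrite 1?setUC // eq_sym.
  have vx : v != x by apply: (nx u).
  rewrite def_e in ce; apply: (@detour H u v x) ce.
  - by apply: (subsetP (subsetUl _ _ : edges G \subset edges H)).
  - exact: adjHx.
  - by rewrite adj_sym adjHx.
have -> : edges H :\: edges G = (spokes x :|: spokes y) :\: edges G.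
  by apply/setP => e; rewrite !inE; case: (e \in edges G).
apply: leq_trans (subset_leq_card (subsetDl _ _)) _.
apply: leq_trans (leq_card_setU _ _) _.
have le h : (#|spokes h| <= #|touched G| + 3)%N.
  apply: leq_trans (leq_imset_card _ _) _.
  apply: leq_trans (subset_leq_card (subsetDl _ _)) _.
  apply: leq_trans (leq_card_setU _ _) _; rewrite addnC leq_add2l.
  apply: leq_trans (leq_card_setU _ _) _; rewrite cards1 addn1 ltnS.
  by rewrite cards2; case: (x != y).
by rewrite mul2n -addnn leq_add.
Qed.

End Hubs.

(** A far graph has a bridge, so [k = #|touched G|] is positive and the [2 (k + 3)] edges of [hubs]
    are at most [8 k]. *)
Lemma far_touched (R : realType) (eps : R) G : (2 < n)%N -> 0 < eps ->
  far_from_edge_biconnected eps G -> eps * (num_edges G)%:R < 8 * #|touched G|%:R.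
Proof.
move=> n2 eps0 far; pose o k (lt : (k < 3)%N) := Ordinal (leq_trans lt n2).
have [H [sGH Hb le]] := @hubs G (o 0%N isT) (o 1%N isT) (o 2%N isT) isT isT isT.
apply: lt_le_trans (far H sGH Hb) _; rewrite -natrM ler_nat.
apply: leq_trans le _.
suff : (0 < #|touched G|)%N by lia.
rewrite lt0n cards_eq0; apply/eqP => /touched_not_biconnected Gb.
have := far G (subxx _) Gb; rewrite setDv cards0 ltNge mulr_ge0 //; exact: ltW.
Qed.

(** * Degrees and the number of targets *)

Definition incident G u : {set {set 'I_n}} := [set e in edges G | u \in e].

Lemma sum_incident G : (\sum_u #|incident G u| = 2 * num_edges G)%N.
Proof.
transitivity (\sum_u \sum_(e in edges G) (u \in e))%N.
  apply: eq_bigr => u _; rewrite -sum1_card big_mkcond [RHS]big_mkcond.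
  by apply: eq_bigr => e _; rewrite inE; case: (e \in edges G); case: (u \in e).
rewrite exchange_big /= mulnC -sum_nat_const; apply: eq_bigr => e eE.
by rewrite -(edges_card2 eE) -sum1_card [RHS]big_mkcond; apply: eq_bigr => u _; case: (u \in e).
Qed.

Lemma degree_incident G u : (degree G u <= #|incident G u|)%N.
Proof.
rewrite /degree -(@card_in_imset _ _ (fun v => [set u; v])) => [|v w].
  apply: subset_leq_card; apply/subsetP => e /imsetP[v]; rewrite inE => uv ->.
  by rewrite inE set21 andbT.
rewrite !inE => uv uw e; have : v \in [set u; w] by rewrite -e set22.
by rewrite !inE => /orP[/eqP vu|/eqP//]; rewrite vu adjxx in uv.
Qed.

Lemma high_degree s G : (#|[set u | s <= degree G u]| * s <= 2 * num_edges G)%N.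
Proof.
rewrite -sum_incident -sum_nat_const big_mkcond /=; apply: leq_sum => u _.
by case: ifP => //; rewrite inE => /leq_trans; apply; exact: degree_incident.
Qed.

Lemma degree_gt0 G u : (0 < degree G u)%N = ~~ isolated G u.
Proof.
apply/card_gt0P/idP => [[v]|]; first by rewrite inE => uv; apply/forallPn; exists v; rewrite negbK.
by case/forallPn => v; rewrite negbK => uv; exists v; rewrite inE.
Qed.

Lemma card_nonisolated G : (#|[set u | ~~ isolated G u]| <= 2 * num_edges G)%N.
Proof.
apply: leq_trans (high_degree 1 G); rewrite muln1 subset_leq_card //.
by apply/subsetP => u; rewrite !inE degree_gt0.
Qed.

Lemma targets_nonisolated s G u : u \in targets s G -> ~~ isolated G u.
Proof.
rewrite inE => /andP[_] /orP[/existsP[v /andP[/andP[uv _] _]]|/existsP[v /andP[_ /and3P[uv _ _]]]];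
  by apply/forallPn; exists v; rewrite negbK.
Qed.

Lemma bridge_sym G u v : bridge G u v -> bridge G v u.
Proof. by rewrite /bridge adj_sym setUC conn_sym. Qed.

Lemma shallow_far_side G u v w : bridge G u v -> ~~ (1 < #|far_side G u v|)%N ->
  adj (edges G) v w -> w = u.
Proof.
move=> uv T1 vw; have [wT|wT] := boolP (w \in far_side G u v).
  have wv : w != v by apply: contraTneq vw => ->; rewrite adjxx.
  case/negP: T1; rewrite (cardsD1 v) far_side_end ltnS; apply/card_gt0P.
  by exists w; rewrite in_setD1 wv.
by have [] := far_side_exit uv (far_side_end G u v) wT vw.
Qed.

(* A bridge endpoint of degree below [s] that is not a target is the only
   neighbour of a target. *)
Lemma touched_targets s G : (1 < s)%N ->
  (#|touched G| <= 2 * #|targets s G| + #|[set u | s <= degree G u]|)%N.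
Proof.
move=> s1; pose nb v := odflt v [pick w | adj (edges G) v w].
suff sub : touched G \subset
    targets s G :|: nb @: targets s G :|: [set u | (s <= degree G u)%N].
  apply: leq_trans (subset_leq_card sub) _; apply: leq_trans (leq_card_setU _ _) _.
  rewrite leq_add2r; apply: leq_trans (leq_card_setU _ _) _.
  by rewrite mul2n -addnn leq_add2l leq_imset_card.
apply/subsetP => u; rewrite inE => /existsP[v uv]; have auv : adj (edges G) u v by case/andP: uv.
rewrite in_setU; have [ds|ds] := leqP s (degree G u).
  by rewrite [X in _ || X]inE ds orbT.
rewrite [X in _ || X]inE leqNgt ds orbF in_setU.
have [T1|T1] := boolP (1 < #|far_side G u v|)%N.
  suff -> : u \in targets s G by [].
  by rewrite inE ds; apply/orP; left; apply/existsP; exists v; rewrite uv.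
have hv w (vw : adj (edges G) v w) : w = u := shallow_far_side uv T1 vw.
have nbv : nb v = u.
  rewrite /nb; case: pickP => [w /hv//|/(_ u)]; by rewrite adj_sym auv.
have dv : (degree G v < s)%N.
  apply: leq_ltn_trans s1; rewrite -(cards1 u) subset_leq_card //.
  by apply/subsetP => w; rewrite !inE => /hv->.
suff [->//|vT] : u \in targets s G \/ v \in targets s G.
  by apply/orP; right; apply/imsetP; exists v.
have vu := bridge_sym uv; have [T1'|T1'] := boolP (1 < #|far_side G v u|)%N.
  by right; rewrite inE dv; apply/orP; left; apply/existsP; exists u; rewrite vu.
have hu w (uw : adj (edges G) u w) : w = v := shallow_far_side vu T1' uw.
(* Both sides of the bridge are single vertices; the smaller end of this [K2] is the target. *)
have k2 : K2b G u v.
  by apply/and3P; split=> //; apply/forallP => w; apply/implyP; [move/hu->|move/hv->].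
have k2' : K2b G v u.
  apply/and3P; split; first by rewrite adj_sym.
    by apply/forallP => w; apply/implyP => /hv->.
  by apply/forallP => w; apply/implyP => /hu->.
have [lt|lt|/val_inj e] := ltngtP u v.
- by left; rewrite inE ds; apply/orP; right; apply/existsP; exists v; rewrite lt.
- by right; rewrite inE dv; apply/orP; right; apply/existsP; exists u; rewrite lt.
- by rewrite e adjxx in auv.
Qed.

(** With [h] vertices of degree at least [s] and [q] targets, [eps m < 8 (2 q + h)]. Since
    [32 h <= eps s h <= 2 eps m], the term [8 h] takes at most half of [eps m]. *)
Lemma targets_many (R : realType) (eps : R) s G : (2 < n)%N -> 0 < eps -> (1 < s)%N ->
  32 <= eps * s%:R -> far_from_edge_biconnected eps G ->
  eps * (num_edges G)%:R < 32 * #|targets s G|%:R.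
Proof.
move=> n2 eps0 s1 es far; have := far_touched n2 eps0 far.
have := touched_targets G s1; rewrite -(ler_nat R) natrD natrM.
have := high_degree s G; rewrite -(ler_nat R) !natrM.
set m := (num_edges G)%:R; set h := #|[set _ | _]|%:R; set q := #|targets _ _|%:R.
set T := #|touched G|%:R => hs le1 lt8.
have : 32 * h <= eps * (h * s%:R).
  rewrite mulrCA; have h0 : 0 <= h by apply: ler0n.
  by have := ler_wpM2l h0 es; lra.
have : eps * (h * s%:R) <= eps * (2 * m) by rewrite ler_pM2l.
by lra.
Qed.

End Targets.

(** * Query programs *)

Section Programs.
Variables (R : realType) (n : nat).
Implicit Types (o : 'I_n -> 'I_n -> R) (G H : sgraph n) (u w : 'I_n) (X : seq 'I_n).
Local Notation alg := (query_alg R n).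
Local Notation row := {ffun 'I_n -> R}.

(** Continuation-passing style: [query_alg] returns only verdicts, whereas subroutines must return
    values. *)
Definition prog (A : Type) := (A -> alg) -> alg.

Definition ret A (a : A) : prog A := fun k => k a.

Definition bind A B (m : prog A) (f : A -> prog B) : prog B :=
  fun k => m (fun a => f a k).

(** Against the oracle [o] the program acts deterministically as returning [a], at a cost of at most
    [q] queries, whatever follows. *)
Definition computes o A (m : prog A) (a : A) (q : nat) := forall k,
  (forall b, prob_verdict o b (m k) = prob_verdict o b (k a)) /\
  (num_queries o (m k) <= q + num_queries o (k a))%N.

Lemma computes_ret o A (a : A) : computes o (ret a) a 0.
Proof. by move=> k; split. Qed.

Lemma computes_bind o A B (m : prog A) (f : A -> prog B) a b q q' :
  computes o m a q -> computes o (f a) b q' -> computes o (bind m f) b (q + q').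
Proof.
move=> ma fb k; have [m1 m2] := ma (fun a => f a k); have [f1 f2] := fb k.
by split=> [c|]; rewrite ?m1 ?f1 //; apply: leq_trans m2 _; rewrite -addnA leq_add2l.
Qed.

Lemma computes_le o A (m : prog A) a q q' : (q <= q')%N -> computes o m a q -> computes o m a q'.
Proof.
move=> qq' ma k; have [m1 m2] := ma k; split=> //; apply: leq_trans m2 _.
by rewrite leq_add2r.
Qed.

Lemma computes_ask o u w : computes o (@Query R n u w) (o u w) 1.
Proof. by move=> k; split; rewrite //= add1n. Qed.

Fixpoint map_prog T A (f : T -> prog A) (l : seq T) : prog (seq A) :=
  if l is x :: l' then bind (f x) (fun a => bind (map_prog f l') (fun s => ret (a :: s)))
  else ret [::].

Lemma computes_map o T S A (f : T -> prog A) (h : S -> T) (g : S -> A) q l :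
  (forall x, computes o (f (h x)) (g x) q) ->
  computes o (map_prog f [seq h x | x <- l]) [seq g x | x <- l] (q * size l).
Proof.
move=> fg; elim: l => [|x l IH] /=; first by rewrite muln0; exact: computes_ret.
rewrite mulnS; apply: computes_bind (fg x) _ => /=; rewrite -[(q * size l)%N]addn0.
by apply: (computes_bind IH); exact: computes_ret.
Qed.

Definition read_row u : prog row :=
  bind (map_prog (@Query R n u) (enum 'I_n)) (fun l => ret [ffun w : 'I_n => nth 0 l w]).

Definition read_known u : prog ('I_n * row) := bind (read_row u) (fun r => ret (u, r)).

Definition orow o u : row := [ffun w => o u w].

Lemma computes_row o u : computes o (read_row u) (orow o u) n.
Proof.
have -> : orow o u = [ffun w : 'I_n => nth 0 [seq o u w | w <- enum 'I_n] w].
  by apply/ffunP => w; rewrite !ffunE (nth_map w) ?size_enum_ord // nth_ord_enum.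
rewrite -[X in computes _ _ _ X]addn0; eapply computes_bind; last exact: computes_ret.
have := @computes_map o _ _ _ (@Query R n u) id (o u) 1 (enum 'I_n) (computes_ask o u).
by rewrite map_id mul1n size_enum_ord.
Qed.

Lemma computes_known o u : computes o (read_known u) (u, orow o u) n.
Proof.
rewrite -[X in computes _ _ _ X]addn0.
by apply: computes_bind (computes_row o u) _; exact: computes_ret.
Qed.

Fixpoint picks_prog u (ru : row) t (A : {set 'I_n}) : prog (seq ('I_n * row)) :=
  if t is t'.+1 then
    if [pick f in A] is Some f then
      bind (read_row f) (fun rf =>
      bind (picks_prog u ru t' (separated u ru rf A)) (fun l => ret ((f, rf) :: l)))
    else ret [::]
  else ret [::].

Definition probe_prog t (kx : seq ('I_n * row)) (p : 'I_n * row) : prog (seq ('I_n * row)) :=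
  bind (picks_prog p.1 p.2 t (candidates p.1 p.2 kx)) (fun P =>
  bind (map_prog (fun q => read_known (companion p.1 p.2 q.2)) (kx ++ P)) (fun Q =>
  ret (P ++ Q))).

Definition visit_prog t X : prog (seq ('I_n * row)) :=
  bind (map_prog read_known X) (fun kx =>
  bind (map_prog (probe_prog t kx) kx) (fun l => ret (kx ++ flatten l))).

Definition known o X := [seq (u, orow o u) | u <- X].

Lemma computes_picks o u t A :
  computes o (picks_prog u (orow o u) t A) (known o (picks (orow o) u t A)) (n * t).
Proof.
elim: t A => [|t IH] A /=; first by rewrite muln0; exact: computes_ret.
case: pickP => [f fA|_]; last exact: computes_le (leq0n _) (computes_ret _ _).
rewrite mulnS; apply: computes_bind (computes_row o f) _.
rewrite -[(n * t)%N]addn0 /=; apply: computes_bind (IH _) _; exact: computes_ret.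
Qed.

Lemma size_picks (rw : 'I_n -> row) u t A : (size (picks rw u t A) <= t)%N.
Proof. by elim: t A => [|t IH] A //=; case: pickP => //= f _; rewrite ltnS. Qed.

Lemma computes_probe o t X u :
  computes o (probe_prog t (known o X) (u, orow o u)) (known o (probe (orow o) t X u))
    (n * t + n * (size X + t)).
Proof.
rewrite /probe /probe_prog /=; set P := picks _ _ _ _.
have -> : known o (P ++ [seq companion u (orow o u) (orow o f) | f <- X ++ P]) =
  known o P ++ [seq (companion u (orow o u) (orow o f),
      orow o (companion u (orow o u) (orow o f))) | f <- X ++ P].
  by rewrite /known map_cat -map_comp.
apply: computes_bind (computes_picks o u t _) _.
apply: (@computes_le _ _ _ _ (n * size (X ++ P) + 0)).
  by rewrite addn0 leq_mul2l size_cat leq_add2l size_picks orbT.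
rewrite -/P; eapply computes_bind; last exact: computes_ret.
rewrite /known -map_cat; apply: computes_map => f.
exact: computes_known.
Qed.

(** Rows read: [|X|] samples and, for each of them, at most [t] picks and [|X| + t] companions, at
    [n] queries per row. *)
Lemma computes_visit o t X :
  computes o (visit_prog t X) (known o (visited (orow o) t X))
    (n * (size X * (size X + t.*2 + 1))).
Proof.
apply: (@computes_le _ _ _ _ (n * size X + ((n * t + n * (size X + t)) * size X + 0))).
  by apply: eq_leq; rewrite -addnn; ring.
have kX : computes o (map_prog read_known X) (known o X) (n * size X).
  have := @computes_map o _ _ _ read_known id (fun u => (u, orow o u)) n X.
  by rewrite map_id => /(_ (computes_known o)).
apply: computes_bind kX _.
have -> : known o (visited (orow o) t X) =
    known o X ++ flatten [seq known o (probe (orow o) t X u) | u <- X].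
  by rewrite /known map_cat map_flatten -map_comp.
eapply computes_bind; last exact: computes_ret.
by apply: computes_map => u; exact: computes_probe.
Qed.

(** A classical truth value depending only on the rows read; queries are the only cost. *)
Definition accept (kn : seq ('I_n * row)) : bool :=
  `[< exists H, edge_biconnected H /\ forall p, p \in kn -> resrow R H p.1 = p.2 >].

Definition finish t X : alg := visit_prog t X (fun kn => @Verdict R n (accept kn)).

Lemma num_queries_finish o t X :
  (num_queries o (finish t X) <= n * (size X * (size X + t.*2 + 1)))%N.
Proof.
by have [_] := computes_visit o t X (fun kn => @Verdict R n (accept kn)); rewrite addn0.
Qed.

Lemma finish_accept G t X : edge_biconnected G ->
  prob_verdict (eff_res R G) true (finish t X) = 1.
Proof.
move=> Gb; have [-> _] := computes_visit (eff_res R G) t X (fun kn => @Verdict R n (accept kn)).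
rewrite /= (_ : accept _ = true) //; apply/asboolP; exists G; split=> // p.
by case/mapP => u _ ->.
Qed.

Lemma finish_reject G t X :
  (forall H, edge_biconnected H -> agree R G H (visited (resrow R G) t X) -> False) ->
  prob_verdict (eff_res R G) false (finish t X) = 1.
Proof.
move=> noH; have [-> _] := computes_visit (eff_res R G) t X (fun kn => @Verdict R n (accept kn)).
rewrite /= (_ : accept _ = false) //; apply/asboolP => [[H [Hb agr]]].
apply: (noH H Hb) => w wV.
by apply: (agr (w, orow (eff_res R G) w)); apply/mapP; exists w.
Qed.

(** * Random draws and the union bound *)

Lemma prob_verdict_ge0 o b (a : alg) : 0 <= prob_verdict o b a.
Proof.
elim: a => [b'|u w f IH|k f IH] /=; rewrite ?ler0n //.
by rewrite mulr_ge0 ?invr_ge0 ?ler0n // sumr_ge0.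
Qed.

(** Sampling with replacement. [Draw] needs a successor as number of outcomes, whence the case
    distinction and [(size e).-1.+1]. *)
Fixpoint draws (e : seq 'I_n) s (acc : seq 'I_n) (k : seq 'I_n -> alg) : alg :=
  if s is s'.+1 then
    if e is x0 :: _ then
      Draw (fun i : 'I_(size e).-1.+1 => draws e s' (nth x0 e i :: acc) k)
    else k acc
  else k acc.

Lemma num_queries_draws o e s acc k q :
  (forall l, (size l <= s + size acc)%N -> (num_queries o (k l) <= q)%N) ->
  (num_queries o (draws e s acc k) <= q)%N.
Proof.
elim: s acc => [|s IH] acc kq /=; first exact: kq.
case: e IH => [|x0 e] IH; first by apply: kq; rewrite addSn leqW // leq_addl.
apply/bigmax_leqP => i _; apply: IH => l lq; apply: kq.
by rewrite addSnnS.
Qed.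

Lemma draws_accept o e s acc k : (forall l, prob_verdict o true (k l) = 1) ->
  prob_verdict o true (draws e s acc k) = 1.
Proof.
move=> k1; elim: s acc => [|s IH] acc //=; case: e IH => [|x0 e] IH //=.
under eq_bigr do rewrite IH.
by rewrite sumr_const card_ord mulVf // pnatr_eq0.
Qed.

(** Union bound over the sets not hit so far, by induction on the number of remaining draws: each
    set has density at least [d] in [N], so it is missed with probability at most [1 - d] per
    draw. *)
Lemma draws_reject o (N : {set 'I_n}) (I : finType) (A : I -> {set 'I_n}) (d : R) s acc k :
  (0 < #|N|)%N -> (forall i, A i \subset N) -> 0 <= d <= 1 ->
  (forall i, d * #|N|%:R <= #|A i|%:R) ->
  (forall l, (forall i, has (mem (A i)) l) -> prob_verdict o false (k l) = 1) ->
  1 - \sum_(i | ~~ has (mem (A i)) acc) (1 - d) ^+ s <=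
    prob_verdict o false (draws (enum N) s acc k).
Proof.
move=> N0 AN /andP[d0 d1] dA khit; elim: s acc => [|s IH] acc /=.
  (* With no draws left, one missed set already makes the bound nonpositive. *)
  have [/forallP all_i|] := boolP [forall i, has (mem (A i)) acc].
    by rewrite khit // big_pred0 ?subr0 // => i; rewrite all_i.
  rewrite negb_forall => /existsP[i ni]; rewrite (bigD1 i) //= expr0 opprD addrA subrr add0r.
  apply: le_trans (prob_verdict_ge0 _ _ _); rewrite oppr_le0.
  by apply: sumr_ge0 => j _; rewrite ?expr0 ler01.
have sz : size (enum N) = #|N| by rewrite cardE.
case defe : (enum N) => [|x0 e]; first by move: N0; rewrite -sz defe.
rewrite defe in IH; pose F x := prob_verdict o false (draws (x0 :: e) s (x :: acc) k).
have -> : prob_verdict o false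
    (Draw (fun i : 'I_(size (x0 :: e)).-1.+1 => draws (x0 :: e) s (nth x0 (x0 :: e) i :: acc) k))
    = #|N|%:R^-1 * \sum_(x in N) F x.
  by rewrite -big_enum -sz defe /= [in RHS](big_nth x0) big_mkord.
have N0' : 0 < #|N|%:R :> R by rewrite ltr0n.
rewrite ler_pdivlMl //.
pose B x := 1 - \sum_(i | ~~ has (mem (A i)) (x :: acc)) (1 - d) ^+ s.
apply: le_trans (_ : \sum_(x in N) B x <= _); last by apply: ler_sum => x _; apply: IH.
have sum1 : \sum_(x in N) 1 = #|N|%:R :> R by rewrite sumr_const.
rewrite /B sumrB sum1 mulrBr mulr1 lerD2l lerN2.
(* The set [A i] stays unhit exactly for the draws in [N :\: A i]. *)
have -> : \sum_(x in N) \sum_(i | ~~ has (mem (A i)) (x :: acc)) (1 - d) ^+ s =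
  \sum_(i | ~~ has (mem (A i)) acc) (1 - d) ^+ s *+ #|N :\: A i|.
  rewrite (exchange_big_dep (fun i => ~~ has (mem (A i)) acc)) /=; last first.
    by move=> x i _; rewrite negb_or => /andP[].
  apply: eq_bigr => i ni; rewrite -sumr_const; apply: eq_bigl => x.
  by rewrite negb_or ni andbT !inE andbC.
rewrite mulr_sumr; apply: ler_sum => i _; rewrite exprS mulrA -mulr_natl.
apply: ler_wpM2r; first by rewrite exprn_ge0 // subr_ge0.
rewrite cardsD (setIidPr (AN i)) natrB ?subset_leq_card //.
by have := dA i; lra.
Qed.

End Programs.

(** * The algorithm, its query count and its error probability *)

Section Algorithm.
Variable R : realType.

Section FixedSize.
Variable n : nat.
Implicit Types (G H : sgraph n) (z w : 'I_n) (N : {set 'I_n}) (zs : seq 'I_n) (s : nat).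

(** A population of at most [s] vertices is read completely, which determines the graph. [zs] holds
    the isolated reference vertex found by the scan, if any. *)
Definition sample s N zs : query_alg R n :=
  if (#|N| <= s)%N then finish R s (zs ++ enum N)
  else draws (enum N) s [::] (fun l => finish R s (zs ++ l)).

(* If two cyclically consecutive vertices have resistance zero, both are
   isolated; otherwise at least half of the vertices are not isolated. *)
Definition algorithm s : query_alg R n :=
  map_prog (fun i : 'I_n => @Query R n i (ordS i)) (enum 'I_n) (fun ans =>
    if [pick i : 'I_n | (i != ordS i) && (nth 1 ans i == 0)] is Some z then
      read_row z (fun rz => sample s [set w | rz w != 0] [:: z])
    else sample s [set: 'I_n] [::]).

(** The guard [i != ordS i] concerns [n = 1], where the successor is the vertex itself, at
    resistance zero. *)
Definition after_scan s G : query_alg R n :=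
  if [pick i : 'I_n | (i != ordS i) && (eff_res R G i (ordS i) == 0)] is Some z then
    sample s [set w | eff_res R G z w != 0] [:: z]
  else sample s [set: 'I_n] [::].

Lemma algorithm_scan s G :
  (forall b, prob_verdict (eff_res R G) b (algorithm s) =
             prob_verdict (eff_res R G) b (after_scan s G)) /\
  (num_queries (eff_res R G) (algorithm s) <=
   n.*2 + num_queries (eff_res R G) (after_scan s G))%N.
Proof.
set o := eff_res R G; pose k (ans : seq R) :=
  if [pick i : 'I_n | (i != ordS i) && (nth 1 ans i == 0)] is Some z then
    read_row z (fun rz => sample s [set w | rz w != 0] [:: z])
  else sample s [set: 'I_n] [::].
have := @computes_map R n o _ _ _ (fun i => @Query R n i (ordS i)) id
  (fun i => o i (ordS i)) 1 (enum 'I_n).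
rewrite map_id mul1n size_enum_ord => /(_ (fun i => computes_ask o i (ordS i)) k) [e1 e2].
pose ans := [seq o i (ordS i) | i <- enum 'I_n].
have ansE (i : 'I_n) : nth 1 ans i = o i (ordS i).
  by rewrite (nth_map i) ?size_enum_ord // nth_ord_enum.
have [k1 k2] : (forall b, prob_verdict o b (k ans) = prob_verdict o b (after_scan s G)) /\
    (num_queries o (k ans) <= n + num_queries o (after_scan s G))%N.
  rewrite /k /after_scan.
  rewrite (@eq_pick _ _ (fun i : 'I_n => (i != ordS i) && (o i (ordS i) == 0))); last first.
    by move=> i; rewrite /= ansE.
  case: pickP => [z _|_]; last by split=> //; exact: leq_addl.
  have -> : [set w | eff_res R G z w != 0] = [set w | orow o z w != 0].
    by apply/setP => w; rewrite !inE ffunE.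
  exact: (computes_row o z (fun rz => sample s [set w | rz w != 0] [:: z])).
split=> [b|]; first by rewrite -k1 -e1.
apply: leq_trans e2 _; rewrite -addnn -addnA leq_add2l; exact: k2.
Qed.

Lemma num_queries_sample o s N zs : (size zs <= 1)%N ->
  (num_queries o (sample s N zs) <= n * (3 * s.+1 ^ 2))%N.
Proof.
move=> zs1; have fin l : (size l <= s)%N ->
    (num_queries o (finish R s (zs ++ l)) <= n * (3 * s.+1 ^ 2))%N.
  move=> ls; apply: leq_trans (num_queries_finish _ _ _) _; rewrite leq_mul2l; apply/orP; right.
  (* With [t = s] the factor is at most [(s + 1) (3 s + 2)]. *)
  have : (size (zs ++ l) <= s.+1)%N by rewrite size_cat; lia.
  move: (size _) => x xs; rewrite -addnn expnS expn1; nia.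
rewrite /sample; case: (leqP #|N| s) => Ns; first by apply: fin; rewrite -cardE.
by apply: num_queries_draws => l; rewrite addn0 => ls; exact: fin.
Qed.

Lemma sample_accept s G N zs : edge_biconnected G ->
  prob_verdict (eff_res R G) true (sample s N zs) = 1.
Proof.
move=> Gb; rewrite /sample; case: (leqP #|N| s) => _; first exact: finish_accept.
by apply: draws_accept => l; apply: finish_accept.
Qed.

(** Replaces an exponential bound on [(1 - d) ^+ k]; the induction rests on
    [(1 - d) (1 + (k + 1) d) <= 1 + k d]. *)
Lemma bernoulli_inv (d : R) k : 0 <= d <= 1 -> (1 - d) ^+ k * (1 + k%:R * d) <= 1.
Proof.
move=> /andP[d0 d1]; elim: k => [|k IH]; first by rewrite expr0 mul0r addr0 mulr1.
apply: le_trans IH; rewrite exprSr -mulrA; apply: ler_wpM2l.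
  by rewrite exprn_ge0 // subr_ge0.
rewrite -natr1; have : 0 <= k%:R :> R by apply: ler0n.
move: (k%:R) => x x0; nra.
Qed.

Lemma leq_5div3 k : (3 <= k)%N -> (k <= 5 * (k %/ 3))%N.
Proof. lia. Qed.

(** Splitting the targets turns one hit in each part into three distinct targets. *)
Lemma disjoint_parts (T : finType) (A : {set T}) k : (3 * k <= #|A|)%N ->
  exists B : 'I_3 -> {set T}, [/\ forall i, B i \subset A, forall i, #|B i| = k
    & forall i j x, x \in B i -> x \in B j -> i = j].
Proof.
move=> k3.
have sub (C : {set T}) : (k <= #|C|)%N -> exists2 B : {set T}, B \subset C & #|B| = k.
  case/card_geqP => l [ul sl lC]; exists [set x in l].
    by apply/subsetP => x; rewrite inE => /lC.
  by rewrite cardsE (card_uniqP ul).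
have [|B0 B0A c0] := sub A; first by lia.
have [|B1 B1A c1] := sub (A :\: B0); first by rewrite cardsD (setIidPr B0A) c0; lia.
have B01 : B0 :|: B1 \subset A.
  by rewrite subUset B0A (subset_trans B1A (subsetDl _ _)).
have d01 : B0 :&: B1 = set0.
  by apply/eqP; rewrite setI_eq0 disjoint_sym; move: B1A; rewrite subsetD => /andP[].
have [|B2 B2A c2] := sub (A :\: (B0 :|: B1)).
  by rewrite cardsD (setIidPr B01) cardsU d01 cards0 c0 c1; lia.
have n1 x : x \in B1 -> x \in B0 = false.
  by move/(subsetP B1A); rewrite inE => /andP[/negbTE].
have n2 x : x \in B2 -> (x \in B0 = false) * (x \in B1 = false).
  by move/(subsetP B2A); rewrite !inE negb_or => /andP[/andP[/negbTE-> /negbTE->]].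
exists (fun i => if val i == 0 then B0 else if val i == 1 then B1 else B2); split.
- move=> i; case: ifP => _ //; case: ifP => _.
    exact: subset_trans B1A (subsetDl _ _).
  exact: subset_trans B2A (subsetDl _ _).
- by move=> i; case: ifP => // _; case: ifP.
- move=> [[|[|[|//]]] pi] [[|[|[|//]]] pj] x /= h1 h2; try exact: val_inj;
    first [by rewrite (n1 x h1) in h2 | by rewrite (n1 x h2) in h1
          | by rewrite (n2 x h1) in h2 | by rewrite (n2 x h2) in h1].
Qed.

Lemma sample_reject s (eps : R) G N zs : 0 < eps -> eps <= 1 -> 6400 <= eps * s%:R ->
  far_from_edge_biconnected eps G ->
  [set u | ~~ isolated G u] \subset N -> (#|N| <= 4 * num_edges G)%N ->
  (forall H, agree R G H (zs ++ enum N) -> edges G = edges H) ->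
  2 / 3 <= prob_verdict (eff_res R G) false (sample s N zs).
Proof.
move=> eps0 eps1 es far isoN N4m full; rewrite /sample; case: (leqP #|N| s) => Ns.
  rewrite finish_reject; first by lra.
  move=> H Hb agr; have eGH : edges G = edges H.
    by apply: full => w wX; apply: agr; rewrite mem_cat wX.
  have Gb : edge_biconnected G.
    by move=> e; rewrite /cut_edge eGH; apply: Hb.
  have := far G (subxx _) Gb; rewrite setDv cards0 ltNge mulr_ge0 //; exact: ltW.
have s6400 : (6400 <= s)%N.
  rewrite -(ler_nat R); apply: le_trans es _.
  by rewrite -[leRHS]mul1r ler_wpM2r.
have n2 : (2 < n)%N.
  have Nn : (#|N| <= n)%N by rewrite -[leqRHS]card_ord max_card.
  by apply: leq_trans Nn; apply: leq_ltn_trans Ns; apply: leq_trans s6400.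
have s1 : (1 < s)%N by apply: leq_trans s6400.
have es' : 32 <= eps * s%:R by lra.
have many := targets_many n2 eps0 s1 es' far.
set A := targets s G in many; set q : R := #|A|%:R in many.
(* From [#|N| <= 4 m] and [eps m < 32 q]. *)
have NqA : eps * #|N|%:R <= 128 * q.
  have : #|N|%:R <= 4 * (num_edges G)%:R :> R by rewrite -natrM ler_nat.
  move=> /(ler_wpM2l (ltW eps0)); lra.
have q3 : 50 <= q.
  have : eps * s%:R <= eps * #|N|%:R by rewrite ler_pM2l // ler_nat ltnW.
  lra.
have k3 : (3 * (#|A| %/ 3) <= #|A|)%N by rewrite mulnC leq_trunc_div.
have [B [BA cB dB]] := disjoint_parts k3.
have kq : q <= 5 * (#|A| %/ 3)%:R.
  by rewrite -natrM ler_nat; apply: leq_5div3; rewrite -(ler_nat R); apply: le_trans q3; lra.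
(* [640 = 128 * 5]: each part has at least [q / 5] vertices, and [q >= eps #|N| / 128]. *)
pose d := eps / 640.
have d01 : 0 <= d <= 1 by rewrite /d; lra.
have AN : A \subset N.
  by apply: subset_trans isoN; apply/subsetP => u /targets_nonisolated; rewrite inE.
have N0 : (0 < #|N|)%N by apply: leq_ltn_trans Ns.
have BN i : B i \subset N by apply: subset_trans (BA i) AN.
have dens i : d * #|N|%:R <= #|B i|%:R by rewrite cB /d; lra.
apply: le_trans (@draws_reject R n _ N 'I_3 B d s [::] _ N0 BN d01 dens _).
  rewrite (eq_bigl predT) // sumr_const card_ord.
  (* Since [s d >= 10], a part is missed with probability at most [1/11], and [3/11 <= 1/3]. *)
  have := bernoulli_inv s d01; have : 10 <= s%:R * d by rewrite /d; lra.
  have : 0 <= (1 - d) ^+ s by rewrite exprn_ge0 // subr_ge0; case/andP: d01.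
  move: ((1 - d) ^+ s) (s%:R * d) => x y x0 y10 xy; clear -x0 y10 xy; nra.
move=> l hit; apply: finish_reject => H Hb.
have pick_i i : exists2 x, x \in zs ++ l & (x \in B i).
  by have /hasP[x xl xB] := hit i; exists x; rewrite // mem_cat xl orbT.
pose i0 : 'I_3 := inord 0; pose i1 : 'I_3 := inord 1; pose i2 : 'I_3 := inord 2.
have [x0 X0 b0] := pick_i i0; have [x1 X1 b1] := pick_i i1; have [x2 X2 b2] := pick_i i2.
have neq i j x y : i != j -> x \in B i -> y \in B j -> x != y.
  by move=> ij xi yj; apply: contraNneq ij => e; rewrite -e in yj; rewrite (dB _ _ _ xi yj).
have v k : (k < 3)%N -> val (inord k : 'I_3) = k by move=> k3'; rewrite /= inordK.
apply: (three_hits X0 X1 X2) => //.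
- by apply: (neq i0 i1); rewrite // -val_eqE !v.
- by apply: (neq i0 i2); rewrite // -val_eqE !v.
- by apply: (neq i1 i2); rewrite // -val_eqE !v.
- exact: (subsetP (BA _)) b0.
- exact: (subsetP (BA _)) b1.
- exact: (subsetP (BA _)) b2.
Qed.

(** The cyclic successor maps isolated vertices injectively to non-isolated ones, so at least half
    of the vertices are non-isolated, and these number at most [2 m]. *)
Lemma isolated_cyclic G :
  (forall i : 'I_n, i != ordS i -> eff_res R G i (ordS i) != 0) ->
  (0 < num_edges G)%N -> (n <= 4 * num_edges G)%N.
Proof.
move=> scan m0; set I := [set u | isolated G u].
have NI : #|~: I| = #|[set u | ~~ isolated G u]|.
  by apply: eq_card => u; rewrite !inE.
have := card_nonisolated G; rewrite -NI => leNI.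
have [n1|n2] := leqP n 1; first by apply: leq_trans n1 _; lia.
have neqS (i : 'I_n) : i != ordS i.
  apply/eqP => /(congr1 val) /=; case: (ltngtP i.+1 n) => [lt||en].
  - by rewrite modn_small //; lia.
  - by have := ltn_ord i; lia.
  - by rewrite en modnn; lia.
have subI : [set ordS u | u in I] \subset ~: I.
  apply/subsetP => w /imsetP[u]; rewrite !inE => iu ->.
  by have := scan u (neqS u); rewrite eff_res_eq0 // iu.
have := subset_leq_card subI; rewrite card_imset; last exact: ordS_inj.
have := cardsC I; rewrite card_ord; lia.
Qed.

Lemma after_scan_reject s (eps : R) G : 0 < eps -> eps <= 1 -> 6400 <= eps * s%:R ->
  far_from_edge_biconnected eps G ->
  2 / 3 <= prob_verdict (eff_res R G) false (after_scan s G).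
Proof.
move=> eps0 eps1 es far; rewrite /after_scan; case: pickP => [z /andP[zS zr]|none].
  have [iz _] : isolated G z /\ isolated G (ordS z).
    by apply/andP; rewrite -(eff_res_eq0 R).
  have zw w : w != z -> (eff_res R G z w != 0) = ~~ isolated G w.
    by move=> wz; rewrite eff_res_eq0 1?eq_sym // iz.
  have NE : [set w | eff_res R G z w != 0] = [set w | ~~ isolated G w].
    apply/setP => w; rewrite !inE; have [->|/zw//] := eqVneq w z.
    by rewrite eff_resxx eqxx iz.
  rewrite NE; apply: (sample_reject eps0 eps1 es far) => //.
    by apply: leq_trans (card_nonisolated G) _; rewrite leq_mul2r orbT.
  (* Vertices whose rows are not read have resistance zero to the isolated [z] in both graphs, so
     they are isolated in [H] too and the unread resistances between them vanish. *)
  move=> H agr; apply: (@eff_res_inj R) => a b.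
  have rowE w v : w \in [:: z] ++ enum [set w | ~~ isolated G w] ->
      eff_res R H w v = eff_res R G w v.
    by move/agr/ffunP/(_ v); rewrite !ffunE.
  have memX w : (w \in [:: z] ++ enum [set w | ~~ isolated G w]) =
      (w == z) || ~~ isolated G w by rewrite inE mem_enum inE.
  case aX: (a \in [:: z] ++ enum [set w | ~~ isolated G w]); first by rewrite rowE.
  case bX: (b \in [:: z] ++ enum [set w | ~~ isolated G w]).
    by rewrite eff_res_sym [RHS]eff_res_sym rowE.
  have [->|nab] := eqVneq a b; first by rewrite !eff_resxx.
  have iso w : (w \in [:: z] ++ enum [set w | ~~ isolated G w]) = false ->
      isolated G w && isolated H w.
    rewrite memX => /negbT; rewrite negb_or negbK => /andP[wz iw]; rewrite iw /=.
    have : eff_res R H z w == 0.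
      by rewrite rowE ?memX ?eqxx // eff_res_eq0 1?eq_sym // iz.
    by rewrite eff_res_eq0 1?eq_sym // => /andP[].
  have /andP[iaG iaH] := iso a aX; have /andP[ibG ibH] := iso b bX.
  have e0 K : isolated K a -> isolated K b -> eff_res R K a b = 0.
    by move=> ia ib; apply/eqP; rewrite eff_res_eq0 // ia.
  by rewrite !e0.
have [m0|m0] := posnP (num_edges G).
  have Gb : edge_biconnected G.
    by move=> e []; move/eqP: m0; rewrite cards_eq0 => /eqP->; rewrite inE.
  by have := far G (subxx _) Gb; rewrite m0 mulr0 setDv cards0 ltxx.
apply: (sample_reject eps0 eps1 es far); first exact: subsetT.
  rewrite cardsT card_ord; apply: isolated_cyclic => // i iS.
  by have := none i; rewrite iS /= => /negbT.
move=> H agr; apply: (@eff_res_inj R) => a b.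
have aX : a \in [::] ++ enum [set: 'I_n] by rewrite mem_enum inE.
by move/ffunP/(_ b): (agr a aX); rewrite !ffunE.
Qed.

End FixedSize.
End Algorithm.

Lemma query_bound (R : realType) (K eps : R) (n q x : nat) : 0 < eps -> 0 <= K ->
  x%:R <= K / eps -> (q <= n * (5 * x ^ 2))%N ->
  q%:R <= 5 * K ^+ 2 * (n%:R / eps ^+ 2 + 1 / eps ^+ 4).
Proof.
move=> eps0 K0 xK; rewrite -(ler_nat R) natrM natrM natrX => /le_trans; apply.
have C0 : 0 <= 5 * K ^+ 2 by rewrite mulr_ge0 // exprn_ge0.
apply: le_trans (_ : n%:R * (5 * (K / eps) ^+ 2) <= _).
  by rewrite ler_wpM2l // ler_wpM2l // lerXn2r ?nnegrE // divr_ge0 // ltW.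
rewrite expr_div_n mulrDr [leLHS](_ : _ = 5 * K ^+ 2 * (n%:R / eps ^+ 2)); last first.
  by field; rewrite gt_eqF.
by rewrite lerDl mulr_ge0 // divr_ge0 // exprn_ge0 // ltW.
Qed.

Theorem mainTheorem2 (R : realType) :
  exists (C : R) (alg : forall n : nat, R -> query_alg R n),
    0 < C /\
    forall (n : nat) (eps : R), 0 < eps -> eps <= 1 ->
    forall G : sgraph n,
      [/\ (num_queries (eff_res R G) (alg n eps))%:R
            <= C * (n%:R / eps ^+ 2 + 1 / eps ^+ 4),
          edge_biconnected G ->
            prob_accept (eff_res R G) (alg n eps) = 1
        & far_from_edge_biconnected eps G ->
            2 / 3 <= prob_reject (eff_res R G) (alg n eps)].
Proof.
have le35 k : (2 + 3 * k.+1 ^ 2 <= 5 * k.+1 ^ 2)%N.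
  by rewrite (mulnDl 2 3) leq_add2r leq_pmulr // expn_gt0.
(* Rounding up gives [6400 <= eps * s], as [sample_reject] requires. As [eps <= 1],
   [s + 1 <= 6400 / eps + 2 <= 6402 / eps], the source of the constant 6402. *)
pose s (eps : R) := (Num.truncn (6400 / eps)).+1.
exists (5 * 6402 ^+ 2), (fun n eps => algorithm R n (s eps)); split.
  by rewrite mulr_gt0 // exprn_gt0 // ltr0n.
move=> n eps eps0 eps1 G.
have [algP algq] := algorithm_scan R (s eps) G.
have div0 : 0 <= 6400 / eps by rewrite divr_ge0 // ltW.
have /andP[lo hi] := truncn_itv div0.
split.
(* The scan and the row of [z] cost at most [2 n] queries, the sampling phase at most
   [3 n (s + 1)^2]. *)
- have le5 : (num_queries (eff_res R G) (algorithm R n (s eps)) <=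
      n * (5 * (s eps).+1 ^ 2))%N.
    apply: leq_trans algq _.
    have : (num_queries (eff_res R G) (after_scan R (s eps) G) <= n * (3 * (s eps).+1 ^ 2))%N.
      by rewrite /after_scan; case: pickP => [z _|_]; apply: num_queries_sample.
    move=> le3; apply: leq_trans (leq_add (leqnn _) le3) _.
    by rewrite -muln2 -mulnDr leq_mul2l le35 orbT.
  apply: (query_bound eps0 _ _ le5); first exact: ler0n.
  have inv1 : 1 <= eps^-1 by rewrite invf_ge1.
  rewrite -[(s eps).+1%:R]natr1 /s -[(Num.truncn _).+1%:R]natr1.
  move: lo inv1; move: ((Num.truncn (6400 / eps))%:R : R) => x; move: eps^-1 => y; clear; lra.
- move=> Gb; rewrite /prob_accept algP /after_scan.
  by case: pickP => [z _|_]; apply: sample_accept.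
- move=> far; rewrite /prob_reject algP; apply: after_scan_reject far => //.
  by move: hi; rewrite ltr_pdivrMr // mulrC => /ltW.
Qed.
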